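(* There exists an absolute constant $C_2\geq 1$ such that the following holds. Let $r\in[1,\infty)$, let $(F,\|\cdot\|)$ be a normed space which may be isometrically embedded in $\ell_r$, and let $X$ be a log-concave random vector with values in $F$. Then for every $p\geq 1$, $$ \left(\mathbb{E}\|X\|^p\right)^{1/p}\leq C_2\, r\left(\mathbb{E}\|X\|+\sup_{\varphi\in F^*,\ \|\varphi\|_*\leq 1}\left(\mathbb{E}|\varphi(X)|^p\right)^{1/p}\right). $$
   Context: A (probability) measure $\mu$ on a locally convex linear space $F$ is called log-concave if for all compact nonempty sets $K,L\subset F$ and all $\lambda\in[0,1]$, $\mu(\lambda K+(1-\lambda)L)\geq \mu(K)^{\lambda}\mu(L)^{1-\lambda}$. A random vector with values in $F$ is log-concave if its distribution is a log-concave measure. $F^*$ is the dual space of $F$ and $\|\cdot\|_*$ the dual norm. $\ell_r$ is the usual real sequence space with norm $\|x\|_r=(\sum_i|x_i|^r)^{1/r}$. ''Absolute constant'' means a constant that does not depend on $r$, $F$, $X$, $p$ or anything else.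
   Formalization: The distribution of X is assumed to be a Radon measure (automatic if F is complete); without this, an incomplete F can carry laws that vanish on all compact sets, hence are vacuously log-concave, and violate the inequality. *)

(* Defs.v *)
From HB Require Import structures.
From mathcomp Require Import all_boot all_order all_algebra.
From mathcomp Require Import all_classical all_reals all_analysis.

Set Implicit Arguments.
Unset Strict Implicit.
Unset Printing Implicit Defensive.

Import Order.TTheory GRing.Theory Num.Theory.
Import numFieldNormedType.Exports.

Local Open Scope classical_set_scope.
Local Open Scope ring_scope.
Local Open Scope ereal_scope.

Notation borel F := (g_sigma_algebraType (@open F)).

(* The inequality refers to [poweR], for which 0 `^ 0 = 1: at lambda = 0 and
   lambda = 1 it is an equality. *)
Definition log_concave (R : realType) (F : normedModType R)
    (mu : {measure set (borel F) -> \bar R}) : Prop :=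
  forall (K L : set F) (lambda : R),
    compact K -> K !=set0 -> compact L -> L !=set0 ->
    (0 <= lambda <= 1)%R ->
    mu K `^ lambda * mu L `^ (1 - lambda) <=
    mu [set (lambda *: x + (1 - lambda) *: y)%R | x in K & y in L].

(* Log-concavity only constrains the mass of compact sets. On a complete
   separable F every finite Borel measure is Radon; a non-complete F may carry
   Borel probability measures that vanish on every compact set, and these are
   all vacuously log-concave. *)
Definition radon (R : realType) (F : normedModType R)
    (mu : {finite_measure set (borel F) -> \bar R}) : Prop :=
  forall A : set (borel F), measurable A ->
    mu A = ereal_sup [set mu K | K in [set K : set F | compact K /\ K `<=` A]].

(* The L^r norm for the counting measure on nat is the norm of l_r, with value
   +oo outside l_r: the equation forces the range of f to lie in l_r. *)
Definition isometrically_embeds_in_ell (R : realType) (r : R)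
    (F : normedModType R) : Prop :=
  exists f : {linear F -> (nat -> R)},
    forall x : F, 'N[counting]_r%:E [EFin \o f x] = (`|x|%R)%:E.

Definition dual_norm (R : realType) (F : normedModType R)
    (phi : {linear F -> R}) : \bar R :=
  ereal_sup [set (`|phi x|%R)%:E | x in [set x : F | (`|x| <= 1)%R]].

Definition dual_ball (R : realType) (F : normedModType R) :
    set {linear F -> R} :=
  [set phi : {linear F -> R} | continuous (phi : F -> R) /\ dual_norm phi <= 1].
Arguments dual_ball {R} F.

(* Main.v *)
Require Import Defs.
From HB Require Import structures.
From mathcomp Require Import all_boot all_order all_algebra.
From mathcomp Require Import all_classical all_reals all_analysis.
From mathcomp Require Import measurable_realfun ring lra.

Set Implicit Arguments.
Unset Strict Implicit.
Unset Printing Implicit Defensive.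

Import Order.TTheory GRing.Theory Num.Theory.
Import numFieldNormedType.Exports.

Local Open Scope classical_set_scope.
Local Open Scope ring_scope.

(* Write mu for the law of X and x_i for its coordinates in l_r; let s exceed
   both E|X| and the weak p-th moment. By Borell's lemma it is enough to show
   P(|X| > D r s) <= exp(-5p), and only finitely many coordinates matter.

   If this fails, G = {|X| > D r s} has mass at least exp(-5p). Cut greedily by
   half-spaces {+-x_i > u} so that mu(G & A) / sqrt(mu(A)) at least doubles at
   each step; the ratio is at most 1, so this stops, at a convex set A of mass
   at least exp(-10p). At that point x_i has exponential tails on G & A at the
   scale of a quantile M_i of |x_i| on A, so integrating |X|^r over G & A shows
   that the vector M has l_r norm at least a large multiple of s (the factor r
   is the growth of the r-th moment of an exponential tail).

   Such a convex set A cannot exist. Log-concavity gives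
   mu(B/2 + K/2) >= sqrt(mu(B) mu(K)) for B in A and K in a typical set where
   the coordinates are on average much smaller than M_i. If, on B, some
   coordinate is spread at scale M_i, split B into two parts separated along it;
   the sets of midpoints are then disjoint and the lower bound improves by a
   constant factor. This can happen O(p) times only, so some B of mass
   exp(-O(p)) has almost all coordinates of a definite sign and of size about
   M_i. One functional of the dual ball is then of order the l_r norm of M on B,
   which contradicts the bound on the weak moment. *)

(** * Probabilities and exponential moments *)

Section probability_facts.
Context (R : realType) d (T : measurableType d) (P : probability T R).
Implicit Types (A B D E : set T) (h : T -> R).

Definition pr A : R := fine (P A).

Lemma prE A : measurable A -> (P : {measure set T -> \bar R}) A = (pr A)%:E.
Proof. by move=> mA; rewrite /pr fineK//; apply: fin_num_measure. Qed.

Lemma pr_ge0 A : 0 <= pr A.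
Proof. exact: fine_ge0. Qed.

Lemma le_pr A B : measurable A -> measurable B -> A `<=` B -> pr A <= pr B.
Proof.
by move=> mA mB AB; rewrite -lee_fin -!prE// le_measure// inE.
Qed.

Lemma prT : pr setT = 1.
Proof. by rewrite /pr probability_setT. Qed.

Lemma pr_le1 A : measurable A -> pr A <= 1.
Proof. by move=> mA; rewrite -prT; apply: le_pr. Qed.

Lemma prDI A B : measurable A -> measurable B ->
  pr A = pr (A `\` B) + pr (A `&` B).
Proof.
move=> mA mB; apply: EFin_inj.
have [mD mI] := (measurableD mA mB, measurableI A B mA mB).
by rewrite EFinD -!prE// -measureDI.
Qed.

Lemma pr_le_cover A B C : measurable A -> measurable B -> measurable C ->
  A `<=` B `|` C -> pr A <= pr B + pr C.
Proof.
move=> mA mB mC ABC; rewrite -lee_fin EFinD -!prE//.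
rewrite (le_trans _ (measureU2 _ mB mC))// le_measure// inE//.
exact: measurableU.
Qed.

Lemma measurable_gt h u : measurable_fun setT h -> measurable [set x | u < h x].
Proof.
move=> mh; have -> : [set x | u < h x] = [set: T] `&` h @^-1` `]u, +oo[.
  by apply/seteqP; split => x /=; rewrite in_itv/= andbT// => -[].
exact: mh.
Qed.

End probability_facts.

Section exponential_tail.
Context (R : realType) d (T : measurableType d) (P : probability T R).
Implicit Types (A B D E : set T) (h : T -> R).
Local Notation pr := (pr P).

Lemma integral_weighted_indic (n : nat) (b : 'I_n -> R) (E : 'I_n -> set T) D :
  (forall i, 0 <= b i) -> (forall i, measurable (E i)) -> measurable D ->
  (\int[P]_(x in D) (\sum_i b i * \1_(E i) x)%:E =
  (\sum_i b i * pr (D `&` E i))%:E)%E.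
Proof.
move=> b0 mE mD; under eq_integral do rewrite -sumEFin.
rewrite ge0_integral_sum//; last 2 first.
- by move=> i; apply/measurable_EFinP/measurable_funM => //;
  exact: measurable_indic.
- by move=> i x _; rewrite lee_fin mulr_ge0.
rewrite -sumEFin; apply: eq_bigr => i _.
under eq_integral do rewrite EFinM.
rewrite ge0_integralZl_EFin//; last first.
  by apply/measurable_EFinP; exact: measurable_indic.
by rewrite integral_indic// setIC prE ?EFinM//; exact: measurableI.
Qed.

Lemma le_mul_pr_integral D h u : measurable D -> measurable_fun setT h ->
  (forall x, 0 <= h x) -> 0 <= u ->
  ((u * pr (D `&` [set x | (u < h x)%R]))%:E <= \int[P]_(x in D) (h x)%:E)%E.
Proof.
move=> mD mh h0 u0; have mE := measurable_gt u mh.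
have mDE := measurableI _ _ mD mE.
rewrite EFinM -prE// -(integral_cst _ mDE).
apply: (@le_trans _ _ (\int[P]_(x in D `&` [set x | (u < h x)%R]) (h x)%:E)%E).
  apply: ge0_le_integral => //.
  - by apply/measurable_EFinP; exact: measurable_funTS.
  - by move=> x [_ /= /ltW]; rewrite lee_fin.
apply: ge0_subset_integral => //; last by move=> x _; rewrite lee_fin.
by apply/measurable_EFinP; exact: measurable_funTS.
Qed.

Lemma expR1_ge2 : 2 <= expR 1 :> R.
Proof. by have := @expR_ge1Dx R 1; lra. Qed.

Lemma expRN_le_half (a : R) (k : nat) : 1 <= a ->
  expR (- (a * k%:R)) <= (2 ^ k)%:R^-1.
Proof.
move=> a1; rewrite expRN lef_pV2 ?posrE ?expR_gt0 ?ltr0n ?expn_gt0//.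
rewrite natrX mulrC expRM_natl lerXn2r ?nnegrE ?expR_ge0//.
by rewrite (le_trans expR1_ge2)// ler_expR.
Qed.

(** Cut at the integers: the part [h <= 1] contributes at most [expR a * pr D], and the layer
    between [k + 1] and [k + 2] at most [c * expR (- (a * k.+2%:R))], because the rate of the tail
    is twice that of the moment. As [expR (- a)] is at most 1/2, these terms sum to at most [c]. *)
Lemma exponential_moment (a c : R) D h : 1 <= a -> 0 <= c -> measurable D ->
  measurable_fun setT h -> (forall x, 0 <= h x) ->
  (forall k, (0 < k)%N ->
    pr (D `&` [set x | k%:R < h x]) <= c * expR (- (2 * a * k.+1%:R))) ->
  (\int[P]_(x in D) (expR (a * h x))%:E <= (expR a * pr D + c)%:E)%E.
Proof.
move=> a1 c0 mD mh h0 tail.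
pose E k := [set x | k.+1%:R < h x].
have mE k : measurable (E k) by exact: measurable_gt.
pose t k (x : T) := (expR (a * k.+2%:R) * \1_(E k) x)%:E.
have t0 k x : (0 <= t k x)%E by rewrite lee_fin mulr_ge0 ?expR_ge0.
have mt k : measurable_fun D (t k).
  apply/measurable_EFinP/measurable_funM => //; exact: measurable_indic.
apply: (@le_trans _ _
    (\int[P]_(x in D) ((expR a)%:E + \sum_(0 <= k <oo) t k x))%E).
  apply: ge0_le_integral => //.
  - apply/measurable_EFinP; apply: measurable_funTS.
    by apply: measurableT_comp => //; apply: measurable_funM.
  - apply: emeasurable_funD => //.
    by apply: ge0_emeasurable_sum => // k x _ _; exact: t0.
  move=> x _; have [h1|h1] := leP (h x) 1.
    rewrite -[leLHS]adde0 leeD// ?nneseries_ge0// lee_fin ler_expR.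
    by rewrite ler_piMr//; lra.
  have h0x : 0 <= h x by [].
  (* The least integer that is at least [h x] is some [k.+2]; then the single term [t k x] dominates
     [expR (a * h x)]. *)
  have /ex_minnP[[|[|k]]] : exists n, h x <= n%:R.
    by exists (Num.truncn (h x)).+1; have /andP[_ /ltW] := truncn_itv h0x.
  - by rewrite leNgt (lt_trans _ h1).
  - by rewrite leNgt h1.
  move=> hk /(_ k.+1) kmin; have kh : k.+1%:R < h x.
    by rewrite ltNge; apply/negP => /kmin; rewrite ltnn.
  rewrite (@le_trans _ _ (t k x))//.
    rewrite /t indicE mem_set// mulr1 lee_fin ler_expR ler_wpM2l//; lra.
  rewrite (@le_trans _ _ (\sum_(0 <= k < k.+1) t k x)%E)//.
    by rewrite big_nat_recr//= leeDr// sume_ge0.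
  rewrite (@le_trans _ _ (\sum_(0 <= k <oo) t k x)%E)//.
    exact: nneseries_lim_ge.
  by rewrite leeDr// lee_fin expR_ge0.
rewrite ge0_integralD//; last 2 first.
- by move=> x _; exact: nneseries_ge0.
- by apply: ge0_emeasurable_sum => // k x _ _; exact: t0.
rewrite EFinD leeD//; first by rewrite (integral_cst _ mD) EFinM prE.
rewrite integral_nneseries//.
apply: (@le_trans _ _ (\sum_(0 <= k <oo) (c / (2 ^ k.+1)%:R)%:E)%E); last first.
  exact: epsilon_trick0.
apply: lee_nneseries => [k _ _|k _]; first exact: integral_ge0.
rewrite /t; under eq_integral do rewrite EFinM.
rewrite ge0_integralZl_EFin ?expR_ge0//; last first.
  by apply/measurable_EFinP; exact: measurable_indic.
rewrite integral_indic// setIC prE; last exact: measurableI.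
rewrite -EFinM lee_fin.
apply: (@le_trans _ _ (expR (a * k.+2%:R) * (c * expR (- (2 * a * k.+2%:R))))).
  by rewrite ler_wpM2l ?expR_ge0 ?tail.
rewrite mulrCA -expRD ler_wpM2l//.
have -> : a * k.+2%:R + - (2 * a * k.+2%:R) = - (a * k.+2%:R) by ring.
rewrite (le_trans (expRN_le_half _ a1))//.
rewrite lef_pV2 ?posrE ?ltr0n ?expn_gt0// ler_nat leq_exp2l//.
Qed.

End exponential_tail.

(** * Elementary inequalities for powers and exponentials *)

Section real_inequalities.
Context (R : realType).

(** Raise [y / r <= expR (y / r)] to the power [r]. The factor r^r is the source of the factor [r]
    in the theorem. *)
Lemma powR_le_expR (r y : R) : 0 < r -> 0 <= y -> y `^ r <= r `^ r * expR y.
Proof.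
move=> r0 y0.
have yr : y <= r * expR (y / r).
  rewrite -ler_pdivrMl// mulrC.
  by apply: le_trans (expR_ge1Dx (y / r)); lra.
apply: (@le_trans _ _ ((r * expR (y / r)) `^ r)).
  by apply: ge0_ler_powR; rewrite ?nnegrE ?mulr_ge0 ?expR_ge0// ltW.
rewrite powRM; [|exact: ltW|exact: expR_ge0].
by rewrite -expRM divfK// gt_eqF.
Qed.

Lemma sqr_le_expR (y : R) : 0 <= y -> y ^+ 2 <= 4 * expR y.
Proof.
move=> y0; have y2 : y / 2 <= expR (y / 2).
  by apply: le_trans (expR_ge1Dx (y / 2)); lra.
have -> : expR y = expR (y / 2) ^+ 2 by rewrite -expRM_natl; congr expR; field.
have : (y / 2) ^+ 2 <= expR (y / 2) ^+ 2.
  by rewrite lerXn2r ?nnegrE ?expR_ge0// divr_ge0.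
rewrite expr_div_n; lra.
Qed.

(** Young's inequality puts the power r above its tangent at the mean [Y]; average the tangents with
    the weights [b]. At [r = 1] the conjugate exponent [q] is infinite, hence the separate case. *)
Lemma power_mean (n : nat) (b y : 'I_n -> R) (r : R) : 1 <= r ->
  (forall i, 0 <= b i) -> \sum_i b i = 1 -> (forall i, 0 <= y i) ->
  (\sum_i b i * y i) `^ r <= \sum_i b i * y i `^ r.
Proof.
rewrite le_eqVlt => /predU1P[<- b0 b1 y0|r1 b0 b1 y0].
  rewrite powRr1 ?sumr_ge0// => [|i _]; last by rewrite mulr_ge0.
  by apply: ler_sum => i _; rewrite powRr1.
have r0 : 0 < r by lra.
set Y := \sum_i b i * y i.
have Y0 : 0 <= Y by apply: sumr_ge0 => i _; rewrite mulr_ge0.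
pose q := r / (r - 1).
have q0 : 0 < q by rewrite divr_gt0//; lra.
have rq : r^-1 + q^-1 = 1 by rewrite /q; field; lra.
have YE : (Y `^ (r - 1)) `^ q = Y `^ r.
  by rewrite -powRrM /q mulrC divfK// gt_eqF//; lra.
have tangent i : y i * Y `^ (r - 1) <= y i `^ r / r + Y `^ r / q.
  by rewrite -YE; apply: conjugate_powR; rewrite ?powR_ge0.
have : \sum_i b i * (y i * Y `^ (r - 1)) <=
       \sum_i b i * (y i `^ r / r + Y `^ r / q).
  by apply: ler_sum => i _; apply: ler_wpM2l.
under eq_bigr do rewrite mulrA.
rewrite -mulr_suml -/Y mulr_powRB1//.
under [leRHS]eq_bigr do rewrite mulrDr !mulrA.
rewrite big_split/= -!mulr_suml b1 mul1r => H.
have qE : q^-1 = 1 - r^-1 by lra.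
rewrite qE in H; set Z := \sum_i _ in H *.
have : Y `^ r / r <= Z / r by lra.
by rewrite ler_pM2r ?invr_gt0.
Qed.

(* AM-GM: [v <= z * v ^+ 2 + (4 * z)^-1]. *)
Lemma quadratic_le_expR (z v : R) : 0 < z <= 1 -> 0 <= v ->
  4^-1 - (2 * z)^-1 - 4 * z * expR v <= - v.
Proof.
move=> /andP[z0 z1] v0; have vexp := sqr_le_expR v0.
have v1 : v <= z * v ^+ 2 + (4 * z)^-1.
  have : 0 <= (2 * z * v - 1) ^+ 2 / (4 * z).
    by rewrite mulr_ge0 ?sqr_ge0// invr_ge0 mulr_ge0// ltW.
  have -> : (2 * z * v - 1) ^+ 2 / (4 * z) = z * v ^+ 2 + (4 * z)^-1 - v.
    by field; rewrite gt_eqF.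
  by rewrite subr_ge0.
have v2 : z * v ^+ 2 <= 4 * z * expR v.
  by rewrite [4 * z]mulrC -mulrA ler_wpM2l// ltW.
have v3 : (2 * z)^-1 = (4 * z)^-1 + (4 * z)^-1 by field; rewrite gt_eqF.
have v4 : 4^-1 <= (4 * z)^-1.
  by rewrite lef_pV2 ?posrE ?mulr_gt0// ler_piMr.
by rewrite v3; clear -v1 v2 v4; lra.
Qed.

End real_inequalities.

(** * Log-concavity and Borell's lemma *)

Section brunn_minkowski.
Context (R : realType) d (T : measurableType d) (P : probability T R).
Context (comb : R -> T -> T -> T).
Implicit Types (A B D E : set T) (h : T -> R).
Local Notation pr := (pr P).

(** The combination of two measurable sets need not be measurable, so [Z] is any measurable set that
    contains it. The operation [comb] enters the argument only through this property and the three
    notions that follow. *)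
Definition brunn_minkowski : Prop := forall (l : R) (B K Z : set T),
  0 < l < 1 -> measurable B -> measurable K -> measurable Z ->
  (forall x y, B x -> K y -> Z (comb l x y)) ->
  pr B `^ l * pr K `^ (1 - l) <= pr Z.

Definition comb_convex A : Prop :=
  forall (l : R) x y, 0 < l < 1 -> A x -> A y -> A (comb l x y).

Definition comb_affine h : Prop := forall (l : R) x y,
  0 < l < 1 -> h (comb l x y) = l * h x + (1 - l) * h y.

(** Norms and absolute values of affine functions share this property, so [borell] serves the whole
    norm as well as single coordinates. *)
Definition comb_reverse_triangle h : Prop := forall (l : R) x y,
  0 < l < 1 -> l * h x - (1 - l) * h y <= h (comb l x y).

Lemma affine_reverse_triangle h : comb_affine h ->
  comb_reverse_triangle (fun x => `|h x|).
Proof.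
move=> ah l x y l01; rewrite ah//.
have [l0 l1] : 0 <= l /\ 0 <= 1 - l by lra.
have -> : l * h x + (1 - l) * h y = l * h x - (- ((1 - l) * h y)) by ring.
apply: le_trans (lerB_dist _ _).
by rewrite normrN !normrM (ger0_norm l0) (ger0_norm l1).
Qed.

(* Borell's lemma: with l = 2 / (k + 1), the set {h > M} contains the
   l-combination of {h > k M} and {h <= M}. *)
Lemma borell (BM : brunn_minkowski) A h (M b e : R) :
  measurable A -> comb_convex A -> measurable_fun setT h ->
  comb_reverse_triangle h -> 0 <= M -> 0 <= b -> 0 <= e ->
  e <= expR (- b) * (1 - e) ->
  pr (A `&` [set x | M < h x]) <= e * pr A ->
  forall k, (0 < k)%N ->
  pr (A `&` [set x | k%:R * M < h x]) <= expR (- (b * k.+1%:R / 2)) * pr A.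
Proof.
move=> mA cA mh rh M0 b0 e0 eb pM k k0.
have mI u : measurable (A `&` [set x | u < h x]).
  by apply: measurableI => //; exact: measurable_gt.
have pA := pr_ge0 P A.
have expb : 0 < expR (- b) <= 1 by rewrite expR_gt0 expR_le1 oppr_le0.
have e1 : e < 1 by rewrite ltNge; apply/negP => e1; nra.
(* For [k = 1] the weight [l] would be 1, outside the open interval; this case follows from the
   hypotheses alone. *)
have [k1|k1] := leqP k 1.
  have -> : k = 1%N by apply/eqP; rewrite eqn_leq k1.
  rewrite mul1r mulfK// (le_trans pM)// ler_wpM2r// (le_trans eb)//.
  by rewrite ler_piMr//; lra.
set B := _ `&` _; have [->|/eqP B0] := eqVneq (pr B) 0.
  by rewrite mulr_ge0// expR_ge0.
have pB : 0 < pr B by rewrite lt0r pr_ge0 andbT; exact/eqP.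
have pA' : 0 < pr A.
  by apply: (lt_le_trans pB); apply: le_pr => //; [exact: mI|exact: subIsetl].
pose l : R := 2 / k.+1%:R.
have k1R : (2 : R) < k.+1%:R by rewrite ltr_nat.
have l01 : 0 < l < 1 by rewrite divr_gt0 ?ltr0n//= ltr_pdivrMr ?ltr0n// mul1r.
pose K := A `\` [set x | M < h x].
have mK : measurable K by apply: measurableD => //; exact: measurable_gt.
have pK : (1 - e) * pr A <= pr K.
  by have := prDI P mA (measurable_gt M mh); rewrite -/K; lra.
have lk : l * k.+1%:R = 2 by rewrite /l divfK// gt_eqF// ltr0n.
have combZ x y : B x -> K y -> (A `&` [set x | M < h x]) (comb l x y).
  move=> [Ax /= hx] [Ay /= /negP]; rewrite -leNgt => hy; split; first exact: cA.
  apply: lt_le_trans (rh _ _ _ l01).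
  have kE : k%:R = k.+1%:R - 1 :> R by rewrite -[k.+1]addn1 natrD addrK.
  have : l * (k%:R * M) < l * h x by rewrite ltr_pM2l//; lra.
  have : (1 - l) * h y <= (1 - l) * M by rewrite ler_wpM2l//; lra.
  rewrite kE; nra.
have := BM l B K _ l01 (mI _) mK (mI _) combZ.
rewrite leNgt => H; rewrite leNgt; apply: contraNN H => H.
(* With [q] a lower bound for [pr K], a mass of [B] above the claimed bound makes the left side
   exceed [expR (- b) * q], which already bounds the mass of [A] above the level [M]. *)
set q := (1 - e) * pr A in pK *.
have q0 : 0 < q by rewrite mulr_gt0//; lra.
apply: (@le_lt_trans _ _ (expR (- b) * q)).
  by rewrite (le_trans pM)// /q mulrA ler_wpM2r.
have qE : q = q `^ l * q `^ (1 - l).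
  rewrite -powRD ?(gt_eqF q0) ?implybT//.
  by have -> : l + (1 - l) = 1 by [ring]; rewrite powRr1 ?ltW.
rewrite {1}qE mulrA; apply: (@lt_le_trans _ _ (pr B `^ l * q `^ (1 - l))).
  rewrite ltr_pM2r ?powR_gt0//.
  have -> : expR (- b) = expR (- (b * k.+1%:R / 2)) `^ l.
    rewrite -expRM; congr expR; rewrite mulNr; congr (- _).
    transitivity (b * (l * k.+1%:R) / 2); last by ring.
    by rewrite lk mulfK.
  rewrite -powRM ?expR_ge0 ?(ltW q0)//.
  apply: gt0_ltr_powR; rewrite ?nnegrE ?mulr_ge0 ?expR_ge0 ?(ltW q0)//.
  - by lra.
  - by lra.
  - exact: pr_ge0.
  - apply: le_lt_trans H; rewrite ler_wpM2l ?expR_ge0// /q.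
    by rewrite ger_pMl//; lra.
rewrite ler_wpM2l ?powR_ge0//.
by apply: ge0_ler_powR; rewrite ?nnegrE ?pr_ge0 ?(ltW q0)//; lra.
Qed.

End brunn_minkowski.

(** * Quantiles and gaps *)

Section quantiles.
Context (R : realType) d (T : measurableType d) (P : probability T R).
Implicit Types (A B D E : set T) (h : T -> R).
Local Notation pr := (pr P).

(** [M] is the first level [2 ^+ k * t] whose tail is small; unless [k = 0], the preceding level
    [M / 2] fails. The floor [t] keeps [M] positive even if [h] vanishes on [A]. *)
Lemma exists_dyadic_quantile A h (e t : R) :
  measurable A -> measurable_fun setT h -> 0 < e -> 0 < t -> 0 < pr A ->
  exists M, [/\ t <= M, pr (A `&` [set x | M < h x]) <= e * pr A &
    M = t \/ e * pr A < pr (A `&` [set x | M / 2 < h x])].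
Proof.
move=> mA mh e0 t0 pA.
pose F (k : nat) := A `&` [set x | 2 ^+ k * t < h x].
have mF k : measurable (F k) by apply: measurableI => //; exact: measurable_gt.
have capF : \bigcap_k F k = set0.
  rewrite -subset0 => x Fx; have [_ /=] := Fx (Num.truncn (h x / t)).+1 I.
  apply/negP; rewrite -leNgt -ler_pdivrMr//.
  have [hx|hx] := leP 0 (h x / t);
    last by rewrite (ltW (lt_le_trans hx _))// exprn_ge0.
  have /andP[_ /ltW /le_trans] := truncn_itv hx; apply.
  by rewrite -natrX ler_nat ltnW// ltn_expl.
have cvgF : (P : {measure set T -> \bar R}) \o F @ \oo --> 0%E.
  rewrite -(measure0 P) -capF; apply: nonincreasing_cvg_mu => //.
  - by rewrite prE// ltry.
  - by rewrite capF.
  apply/nonincreasing_seqP => k; apply/subsetPset => x [Ax /= hx]; split=> //=.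
  by apply: le_lt_trans hx; rewrite ler_pM2r// ler_eXn2l// ltr1n.
have /ex_minnP[k pk kmin] : exists k, pr (F k) <= e * pr A.
  have /fine_cvgP[_ /cvgrPdist_lt/(_ _ (mulr_gt0 e0 pA))[N _ /(_ N (leqnn N))]]
    := cvgF.
  rewrite sub0r normrN /= => H; exists N; apply: le_trans (ltW H).
  exact: ler_norm.
exists (2 ^+ k * t); split => //.
  by rewrite ler_peMl ?(ltW t0)// exprn_ege1// ler1n.
case: k pk kmin => [|k] pk kmin; first by left; rewrite expr0 mul1r.
right; rewrite ltNge; apply/negP => H; have := kmin k; rewrite ltnn => kk.
suff : false by []; apply: kk; rewrite /F.
by have <- : 2 ^+ k.+1 * t / 2 = 2 ^+ k * t by rewrite exprS; field.
Qed.

Lemma sum_pr_le n (b : 'I_n -> R) (E : 'I_n -> set T) D (u : R) :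
  (forall i, 0 <= b i) -> (forall i, measurable (E i)) -> measurable D ->
  (forall x, D x -> \sum_i b i * \1_(E i) x <= u) ->
  \sum_i b i * pr (D `&` E i) <= u * pr D.
Proof.
move=> b0 mE mD ub; rewrite -lee_fin -integral_weighted_indic//.
rewrite EFinM -prE// -(integral_cst _ mD).
apply: ge0_le_integral => //.
- by move=> x _; rewrite lee_fin sumr_ge0// => i _; rewrite mulr_ge0.
- apply/measurable_EFinP; apply: measurable_sum => i.
  by apply: measurable_funM => //; exact: measurable_indic.
Qed.

Lemma finite_markov n (b : 'I_n -> R) (E : 'I_n -> set T) D (u : R) :
  (forall i, 0 <= b i) -> (forall i, measurable (E i)) -> measurable D ->
  0 <= u ->
  u * pr (D `&` [set x | u < \sum_i b i * \1_(E i) x]) <=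
  \sum_i b i * pr (D `&` E i).
Proof.
move=> b0 mE mD u0; rewrite -lee_fin -integral_weighted_indic//.
apply: le_mul_pr_integral => //.
- apply: measurable_sum => i.
  by apply: measurable_funM => //; exact: measurable_indic.
- by move=> x; rewrite sumr_ge0// => i _; rewrite mulr_ge0.
Qed.

(* Among the L slices of ]1/4, 1/2] one carries at most p / L of the mass, and
   removing it separates the mass into two parts neither of which is small. *)
Lemma exists_gap (G : R -> R) (p t : R) (L : nat) :
  {homo G : u v /~ u <= v} -> (forall u, 0 <= G u <= p) ->
  0 < t <= 1 -> 2 <= t * L%:R -> 0 < p ->
  t ^+ 2 * p <= G 2^-1 -> G 4^-1 <= (1 - t ^+ 2) * p ->
  exists a, [/\ t ^+ 2 * p <= G (a + (4 * L%:R)^-1),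
    t ^+ 2 * p <= p - G a &
    (1 + t / 2) * p <=
    (Num.sqrt (p - G a) + Num.sqrt (G (a + (4 * L%:R)^-1))) ^+ 2].
Proof.
move=> Gmono G0p t01 tL p0 G2 G4.
have L0 : 0 < L%:R :> R by rewrite ltNge; apply/negP => L0; nra.
pose a (j : nat) : R := 4^-1 + j%:R / (4 * L%:R).
have aS j : a j.+1 = a j + (4 * L%:R)^-1.
  by rewrite /a -natr1; field; rewrite gt_eqF.
have aL : a L = 2^-1 by rewrite /a; field; rewrite gt_eqF.
have tele : \sum_(0 <= j < L) (G (a j) - G (a j.+1)) <= p.
  rewrite (eq_bigr (fun j => - (G (a j.+1) - G (a j)))) => [|j _];
    last by rewrite opprB.
  rewrite sumrN telescope_sumr// opprB.
  by have := G0p (a 0%N); have := G0p (a L); lra.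
have [j [jL Gj]] : exists j, (j < L)%N /\ G (a j) - G (a j.+1) <= p / L%:R.
  apply: contrapT => /forallNP nj; move: tele; apply/negP; rewrite -ltNge.
  have Lnat : (0 < L)%N by rewrite -(ltr_nat R).
  have -> : p = \sum_(0 <= j < L) p / L%:R.
    by rewrite sumr_const_nat subn0 -[RHS]mulr_natr divfK// gt_eqF.
  rewrite !big_mkord; apply: ltr_sum; first by apply/hasP;
    exists (Ordinal Lnat); rewrite ?mem_index_enum.
  move=> i _; rewrite ltNge; apply/negP => H; exact: (nj i).
exists (a j); rewrite -aS.
have x1 : t ^+ 2 * p <= p - G (a j).
  have : G (a j) <= G 4^-1.
    by apply: Gmono; rewrite /a lerDl divr_ge0// mulr_ge0// ltW.
  lra.
have y1 : t ^+ 2 * p <= G (a j.+1).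
  apply: (le_trans G2); apply: Gmono; rewrite -aL /a lerD2l.
  by rewrite ler_pM2r ?invr_gt0 ?mulr_gt0// ler_nat.
split=> //.
set x := p - G (a j) in x1 *; set y := G (a j.+1) in y1 Gj *.
have t2p : 0 < t ^+ 2 * p by rewrite mulr_gt0// exprn_gt0//; lra.
have x0 : 0 < x by lra.
have y0 : 0 < y by lra.
have pL : p / L%:R <= p * (t / 2).
  by rewrite ler_pM2l// -[L%:R^-1]mul1r ler_pdivrMr//; lra.
have xy : p * (1 - t / 2) <= x + y by rewrite /x; lra.
(* One of [x] and [y] is at least [p / 4], their sum being at least [p / 2]; the other is at least
   [t ^+ 2 * p]. So the cross term of the square is at least [t * p], twice the mass lost in the
   slice. *)
have xyM : (t * p / 2) ^+ 2 <= x * y.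
  have : p / 4 <= x \/ p / 4 <= y.
    by have [|] := leP (p / 4) x; [left|right => //; nra].
  have -> : (t * p / 2) ^+ 2 = t ^+ 2 * p * (p / 4) by field.
  case=> ?; first by rewrite mulrC ler_pM//; lra.
  by rewrite ler_pM//; lra.
rewrite sqrrD !sqr_sqrtr ?(ltW x0) ?(ltW y0)// -sqrtrM ?(ltW x0)//.
have : t * p / 2 <= Num.sqrt (x * y).
  rewrite -(ger0_norm (_ : 0 <= t * p / 2)); last by rewrite !mulr_ge0//; lra.
  by rewrite -sqrtr_sqr ler_wsqrtr.
rewrite (mulr2n (Num.sqrt _)); move: (Num.sqrt (x * y)) => q qxy.
have -> : (1 + t / 2) * p = p * (1 - t / 2) + (t * p / 2 + t * p / 2) by field.
lra.
Qed.

End quantiles.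

(** * Coordinates of definite sign, or a gap along one of them *)

Section localization.
Context (R : realType) d (T : measurableType d) (P : probability T R).
Context (n : nat) (b : 'I_n -> R) (y : 'I_n -> T -> R).
Implicit Types (A B D E K : set T) (h : T -> R).
Local Notation pr := (pr P).
Context (b0 : forall i, 0 <= b i).
Context (b1 : \sum_i b i = 1).
Context (my : forall i, measurable_fun setT (y i)).

(* Along [s * y i] the set [B] has two parts separated by [(4 * L)^-1], which is
   twice the bound on [`|y i|] that holds on [K] up to a proportion [e]. *)
Definition gap_along (K B : set T) (e t : R) (L : nat) (i : 'I_n) (s a : R) :=
  [/\ s = 1 \/ s = -1,
    pr (K `&` [set x | (8 * L%:R)^-1 < `|y i x|]) <= e * pr K,
    t ^+ 2 * pr B <= pr (B `&` [set x | a + (4 * L%:R)^-1 < s * y i x]),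
    t ^+ 2 * pr B <= pr (B `\` [set x | a < s * y i x]) &
    (1 + t / 2) * pr B <=
      (Num.sqrt (pr (B `\` [set x | a < s * y i x])) +
       Num.sqrt (pr (B `&` [set x | a + (4 * L%:R)^-1 < s * y i x]))) ^+ 2].

Lemma le_weighted_sum (Q : pred 'I_n) (f : 'I_n -> R) (u : R) :
  0 <= u -> (forall i, Q i -> f i <= u) -> \sum_(i | Q i) b i * f i <= u.
Proof.
move=> u0 fu; apply: (@le_trans _ _ (\sum_(i | Q i) b i * u)).
  by apply: ler_sum => i Qi; apply: ler_wpM2l => //; exact: fu.
rewrite -mulr_suml -[leRHS]mul1r ler_wpM2r// -b1 [leRHS](bigID Q)/=.
by rewrite lerDl sumr_ge0.
Qed.

Lemma measurable_pos_part B u s i : measurable B ->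
  measurable (B `&` [set x | u < s * y i x]).
Proof.
by move=> mB; apply: measurableI => //; apply: measurable_gt;
  exact: measurable_funM.
Qed.

Lemma measurable_abs_part B u i : measurable B ->
  measurable (B `&` [set x | u < `|y i x|]).
Proof.
move=> mB; apply: measurableI => //; apply: measurable_gt.
exact: measurableT_comp.
Qed.

(** A coordinate is good if it exceeds 1/2 in absolute value on a fixed proportion of [B] and is
    small on most of [K]. If a good coordinate leaves a proportion [t ^+ 2] of [B] on both sides of
    the band from 1/4 to 1/2, [exists_gap] applies. Otherwise each good coordinate, with a suitable
    sign, exceeds 1/4 on nearly all of [B], and Markov's inequality gives half of [B] where the
    wrong signs have little weight. *)
Lemma signs_or_gap (B K : set T) (delta z t e c3 kappa : R) (L : nat) :
  measurable B -> measurable K -> 0 < pr B -> 0 < pr K ->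
  0 < delta <= 1 -> 0 < z <= 1 -> 4 * z * c3 <= delta / 256 ->
  0 < t <= 1 -> t ^+ 2 <= z * (delta / 256) -> 0 < e -> 2 <= t * L%:R ->
  2 * kappa * (8 * L%:R) <= e * (delta / 16) ->
  delta / 4 * pr B <=
  \sum_i b i * pr (B `&` [set x | 2^-1 < `|y i x|]) ->
  (forall x, B x -> \sum_i b i * expR `|y i x| <= c3) ->
  (forall x, K x -> \sum_i b i * `|y i x| <= 2 * kappa) ->
  (exists (eps : 'I_n -> R) B', [/\ forall i, `|eps i| <= 1, measurable B',
     B' `<=` B, pr B / 2 <= pr B' &
     forall x, B' x -> delta / 128 <= \sum_i b i * (eps i * y i x)]) \/
  (exists i s a, gap_along K B e t L i s a).
Proof.
move=> mB mK pB pK delta01 z01 zc t01 tz e0 tL kappaE hB vB hK.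
have [d0 z0 t0] : [/\ 0 < delta, 0 < z & 0 < t].
  by case/andP: delta01 => -> _; case/andP: z01 => -> _; case/andP: t01 => -> _.
have L0 : 0 < L%:R :> R.
  rewrite ltNge; apply/negP => L0; have : t * L%:R <= 0.
    by rewrite mulr_ge0_le0// ltW.
  by lra.
pose large i := delta / 8 * pr B <= pr (B `&` [set x | 2^-1 < `|y i x|]).
pose steady i := pr (K `&` [set x | (8 * L%:R)^-1 < `|y i x|]) <= e * pr K.
pose good i := large i && steady i.
have weight_large : delta / 8 <= \sum_(i | large i) b i.
  have : \sum_(i | ~~ large i) b i * pr (B `&` [set x | 2^-1 < `|y i x|]) <=
      delta / 8 * pr B.
    apply: le_weighted_sum => [|i]; first by rewrite mulr_ge0 ?(ltW pB)//; lra.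
    by rewrite -ltNge => /ltW.
  have : \sum_(i | large i) b i * pr (B `&` [set x | 2^-1 < `|y i x|]) <=
      (\sum_(i | large i) b i) * pr B.
    rewrite mulr_suml; apply: ler_sum => i _; apply: ler_wpM2l => //.
    by apply: le_pr => //; exact: measurable_abs_part.
  move: hB; rewrite (bigID large)/= => h1 h2 h3.
  have : delta / 8 * pr B <= (\sum_(i | large i) b i) * pr B by lra.
  by rewrite ler_pM2r.
have weight_unsteady : \sum_(i | ~~ steady i) b i <= delta / 16.
  pose E i := [set x | (8 * L%:R)^-1 < `|y i x|].
  have mE i : measurable (E i).
    by rewrite -[E i]setTI; exact: measurable_abs_part.
  have : \sum_i b i * pr (K `&` E i) <= 2 * kappa * (8 * L%:R) * pr K.
    apply: sum_pr_le => // x /hK Kx.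
    apply: (@le_trans _ _ ((\sum_i b i * `|y i x|) * (8 * L%:R))).
      rewrite mulr_suml; apply: ler_sum => i _; rewrite -mulrA ler_wpM2l//.
      rewrite indicE; case: (boolP (x \in E i)) => [/set_mem/= /ltW|_] /=.
        by rewrite -ler_pdivrMr ?mulr_gt0// mul1r.
      by rewrite !mulr_ge0// ltW.
    by rewrite ler_wpM2r// mulr_ge0// ltW.
  rewrite (bigID steady)/= => H.
  have : e * (\sum_(i | ~~ steady i) b i) * pr K <=
      \sum_(i | ~~ steady i) b i * pr (K `&` E i).
    rewrite mulr_sumr mulr_suml; apply: ler_sum => i; rewrite -ltNge => /ltW ns.
    by rewrite mulrAC mulrC ler_wpM2l.
  have : 0 <= \sum_(i | steady i) b i * pr (K `&` E i).
    by apply: sumr_ge0 => i _; rewrite mulr_ge0 ?pr_ge0.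
  move=> h1 h2; have h3 : e * (\sum_(i | ~~ steady i) b i) * pr K <=
      e * (delta / 16) * pr K.
    apply: (le_trans h2);
      apply: (@le_trans _ _ (2 * kappa * (8 * L%:R) * pr K)).
      lra.
    by rewrite ler_wpM2r// ltW.
  by rewrite -(ler_pM2l e0) -(ler_pM2r pK).
have weight_good : delta / 16 <= \sum_(i | good i) b i.
  have : \sum_(i | large i) b i <=
      \sum_(i | good i) b i + \sum_(i | ~~ steady i) b i.
    rewrite (bigID steady)/= lerD2l [leRHS](bigID large)/=.
    rewrite (eq_bigl (fun i => ~~ steady i && large i)) => [|i];
      last exact: andbC.
    by rewrite lerDl sumr_ge0.
  by have := weight_large; have := weight_unsteady; lra.
have [[i [s [gi s1 H2 H4]]]|nogap] := pselect (exists i s, [/\ good i,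
    s = 1 \/ s = -1, t ^+ 2 * pr B <= pr (B `&` [set x | 2^-1 < s * y i x]) &
    pr (B `&` [set x | 4^-1 < s * y i x]) <= (1 - t ^+ 2) * pr B]).
  right; pose G u := pr (B `&` [set x | u < s * y i x]).
  have mG u := measurable_pos_part u s i mB.
  have DG u : pr (B `\` [set x | u < s * y i x]) = pr B - G u.
    have mS : measurable [set x | u < s * y i x].
      by rewrite -[X in measurable X]setTI; exact: measurable_pos_part.
    by rewrite (prDI P mB mS) addrK.
  have [|u|a [h1 h2 h3]] := @exists_gap R G (pr B) t L _ _ t01 tL pB H2 H4.
  - move=> u v uv; apply: le_pr => // x [Bx /= hx]; split => //=.
    exact: le_lt_trans hx.
  - by rewrite pr_ge0 le_pr//; exact: subIsetl.
  by exists i, s, a; split; rewrite ?DG//; case/andP : gi.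
left.
(* For a good [i] the test can fail only if [- y i] exceeds 1/2 on a proportion at least
   [delta / 16] of [B], so [nogap] applies to the sign [s i] in both cases. *)
pose s i : R := if t ^+ 2 * pr B <= pr (B `&` [set x | 2^-1 < 1 * y i x])
                then 1 else -1.
have s1 i : s i = 1 \/ s i = -1 by rewrite /s; case: ifP; [left|right].
have sabs i x : s i * y i x <= `|y i x|.
  apply: le_trans (ler_norm _) _; rewrite normrM.
  by case: (s1 i) => ->; rewrite ?normrN normr1 mul1r.
have sabsN i x : - `|y i x| <= s i * y i x.
  rewrite lerNl; apply: le_trans (ler_norm _) _; rewrite normrN normrM.
  by case: (s1 i) => ->; rewrite ?normrN normr1 mul1r.
have t2d : t ^+ 2 <= delta / 16.
  apply: (le_trans tz); apply: (@le_trans _ _ (1 * (delta / 256))).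
    by rewrite ler_wpM2r ?divr_ge0 ?(ltW d0)//; case/andP: z01.
  by lra.
have sgood i : good i ->
    (1 - t ^+ 2) * pr B < pr (B `&` [set x | 4^-1 < s i * y i x]).
  move=> gi; rewrite ltNge; apply/negP => H4; apply: nogap.
  exists i, (s i); split => //.
  rewrite /s; case: ifPn => //; rewrite -ltNge => H1.
  have : pr (B `&` [set x | 2^-1 < `|y i x|]) <=
      pr (B `&` [set x | 2^-1 < 1 * y i x]) +
      pr (B `&` [set x | 2^-1 < -1 * y i x]).
    apply: pr_le_cover; [exact: measurable_abs_part|exact: measurable_pos_part
      |exact: measurable_pos_part|].
    move=> x [Bx /=]; case: (ger0P (y i x)) => _ hx; [left|right]; split => //=.
    - by rewrite mul1r.
    - by rewrite mulN1r.
  case/andP: gi => li _; move: li; rewrite /large.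
  have : t ^+ 2 * pr B <= delta / 16 * pr B by rewrite ler_wpM2r// ltW.
  lra.
pose E i := ~` [set x | 4^-1 < s i * y i x].
have mpos i : measurable [set x | 4^-1 < s i * y i x].
  by rewrite -[X in measurable X]setTI; exact: measurable_pos_part.
have mE i : measurable (E i) by exact: measurableC.
pose w i := if good i then b i else 0.
have w0 i : 0 <= w i by rewrite /w; case: ifP.
have sw : delta / 16 <= \sum_i w i by rewrite -big_mkcond.
have sbad : \sum_i w i * pr (B `&` E i) <= t ^+ 2 * pr B.
  have -> : \sum_i w i * pr (B `&` E i) = \sum_(i | good i) b i * pr (B `&` E
    i).
    by rewrite [RHS]big_mkcond; apply: eq_bigr => i _; rewrite /w; case: ifP;
      rewrite ?mul0r.
  apply: le_weighted_sum => [|i gi]; first by rewrite mulr_ge0 ?sqr_ge0// ltW.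
  have := prDI P mB (mpos i); rewrite -setDE.
  by have := sgood _ gi; lra.
pose U x := \sum_i w i * \1_(E i) x.
have mU : measurable [set x | 2 * t ^+ 2 < U x].
  apply: measurable_gt; apply: measurable_sum => i.
  by apply: measurable_funM => //; exact: measurable_indic.
have t20 : 0 < t ^+ 2 by rewrite exprn_gt0//; lra.
have pU : pr (B `&` [set x | 2 * t ^+ 2 < U x]) <= pr B / 2.
  have u0 : 0 <= 2 * t ^+ 2 by lra.
  have := finite_markov P w0 mE mB u0; rewrite -/U => H.
  have : 2 * t ^+ 2 * pr (B `&` [set x | 2 * t ^+ 2 < U x]) <= t ^+ 2 * pr B.
    exact: le_trans H sbad.
  rewrite -mulrA mulrCA ler_pM2l//; lra.
exists (fun i => if good i then s i else 0), (B `\` [set x | 2 * t ^+ 2 < U x]).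
split.
- move=> i; case: ifP => _; last by rewrite normr0.
  by case: (s1 i) => ->; rewrite ?normrN normr1.
- exact: measurableD.
- by move=> x [].
- by have := prDI P mB mU; lra.
move=> x [Bx /negP]; rewrite -leNgt => Ux.
(* [U x] is the weight of the wrong signs at [x]. By [quadratic_le_expR] each costs at most
   [(2 * z)^-1] up to a small multiple of the exponential. What remains is delta/64 - delta/256 -
   delta/256 = delta/128. *)
have lower i : 4^-1 - (2 * z)^-1 * \1_(E i) x - 4 * z * expR `|y i x| <=
    s i * y i x.
  have ez : 0 <= 4 * z * expR `|y i x|.
    by rewrite mulr_ge0 ?expR_ge0// mulr_ge0// ltW.
  rewrite indicE; case: (boolP (x \in E i)) => [_|/negP nE] /=; last first.
    have : 4^-1 < s i * y i x.
      by apply: contrapT => H; apply: nE; exact: mem_set.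
    by lra.
  apply: le_trans (sabsN i x); rewrite mulr1.
  exact: quadratic_le_expR.
have -> : \sum_i b i * ((if good i then s i else 0) * y i x) =
          \sum_i w i * (s i * y i x).
  by apply: eq_bigr => i _; rewrite /w; case: ifP => //; rewrite !mul0r mulr0.
apply: (@le_trans _ _ (\sum_i w i *
    (4^-1 - (2 * z)^-1 * \1_(E i) x - 4 * z * expR `|y i x|))); last first.
  by apply: ler_sum => i _; rewrite ler_wpM2l.
have -> : \sum_i w i *
    (4^-1 - (2 * z)^-1 * \1_(E i) x - 4 * z * expR `|y i x|) =
    (\sum_i w i) / 4 - U x / (2 * z) - 4 * z * \sum_i w i * expR `|y i x|.
  rewrite /U !mulr_suml mulr_sumr -!sumrB; apply: eq_bigr => i _.
  by ring.
have wV : \sum_i w i * expR `|y i x| <= c3.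
  apply: le_trans (vB _ Bx); apply: ler_sum => i _;
    rewrite ler_wpM2r ?expR_ge0//.
  by rewrite /w; case: ifP.
have h1 : U x / (2 * z) <= delta / 256.
  rewrite ler_pdivrMr ?mulr_gt0//; apply: (le_trans Ux).
  by lra.
have h2 : 4 * z * \sum_i w i * expR `|y i x| <= delta / 256.
  by apply: le_trans zc; rewrite ler_wpM2l// mulr_ge0// ltW.
by lra.
Qed.

End localization.

(** * Growth of the mass of midpoints *)

Section mass_growth.
Context (R : realType) d (T : measurableType d) (P : probability T R).
Context (comb : R -> T -> T -> T).
Context (n : nat) (y : 'I_n -> T -> R).
Implicit Types (A B D E K Z : set T).
Local Notation pr := (pr P).

(* Each gap splits the midpoints of [B] and [K] into two disjoint sets, and this
   multiplies the square of the lower bound on their mass by a factor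
   [(1 + t / 2) * (1 - e)]. *)
Lemma mass_growth (A1 K0 : set T) (e t beta : R) (L : nat) :
  brunn_minkowski P comb ->
  (forall i, measurable_fun setT (y i)) -> (forall i, comb_affine comb (y i)) ->
  0 < t <= 1 -> 0 <= e <= 1 ->
  (forall B K, measurable B -> measurable K -> B `<=` A1 -> K `<=` K0 ->
    beta <= pr B -> 0 < pr K ->
    exists i s a, gap_along P y K B e t L i s a) ->
  forall k B K Z, measurable B -> measurable K -> measurable Z ->
    B `<=` A1 -> K `<=` K0 ->
    (forall x v, B x -> K v -> Z (comb 2^-1 x v)) ->
    beta <= t ^+ (2 * k) * pr B ->
    Num.sqrt (((1 + t / 2) * (1 - e)) ^+ k * pr B * pr K) <= pr Z.
Proof.
move=> BM my ay t01 e01 gap; have h01 : 0 < (2^-1 : R) < 1 by lra.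
elim=> [|k IH] B K Z mB mK mZ BA KK combZ betaB.
  rewrite mul1r; apply: le_trans (BM _ _ _ _ h01 mB mK mZ combZ).
  have -> : 1 - 2^-1 = 2^-1 :> R by field.
  by rewrite !powR12_sqrt ?pr_ge0// sqrtrM ?pr_ge0.
have [pK0|/eqP pK0] := eqVneq (pr K) 0;
  first by rewrite pK0 mulr0 sqrtr0 pr_ge0.
have pK : 0 < pr K by rewrite lt0r pr_ge0 andbT; exact/eqP.
have t0 : 0 <= t by lra.
have tk1 m : t ^+ m <= 1 by rewrite exprn_ile1//; lra.
have betaB' : beta <= pr B by rewrite (le_trans betaB)// ler_piMl// pr_ge0.
have [i [s [a [s1 steady B2 B1 growth]]]] := gap B K mB mK BA KK betaB' pK.
have mpos u : measurable [set x | u < s * y i x].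
  by apply: measurable_gt; exact: measurable_funM.
have mabs : measurable [set x | (8 * L%:R)^-1 < `|y i x|].
  by apply: measurable_gt; exact: measurableT_comp.
set D1 := B `\` _ in B1 growth; set D2 := B `&` _ in B2 growth.
pose K1 := K `\` [set x | (8 * L%:R)^-1 < `|y i x|].
(* On [K1] the coordinate is at most [(8 * L%:R)^-1] in absolute value and moves a midpoint by at
   most half of that. Hence midpoints with [D1] stay at or below [mid], those with [D2] strictly
   above it. *)
pose mid : R := a / 2 + (16 * L%:R)^-1.
have mD1 : measurable D1 by exact: measurableD.
have mD2 : measurable D2 by exact: measurableI.
have mK1 : measurable K1 by exact: measurableD.
have pK1 : (1 - e) * pr K <= pr K1 by have := prDI P mK mabs; rewrite -/K1; lra.
have sy x : K1 x -> - (8 * L%:R)^-1 <= s * y i x <= (8 * L%:R)^-1.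
  move=> [_ /negP /=]; rewrite -leNgt ler_norml => yx.
  by case: s1 => ->; rewrite ?mul1r ?mulN1r// lerN2 lerNl andbC.
have mide x v : s * y i (comb 2^-1 x v) = s * y i x / 2 + s * y i v / 2.
  by rewrite ay//; field.
have L8 : (8 * L%:R)^-1 = (16 * L%:R)^-1 + (16 * L%:R)^-1 :> R.
  by rewrite !invfM; lra.
have L4 : (4 * L%:R)^-1 = (8 * L%:R)^-1 + (8 * L%:R)^-1 :> R.
  by rewrite !invfM; lra.
(* Each part keeps at least the proportion [t ^+ 2] of [B], so the threshold for [k.+1] steps
   implies that for [k] steps. *)
have IH1 : Num.sqrt (((1 + t / 2) * (1 - e)) ^+ k * pr D1 * pr K1) <=
    pr (Z `\` [set x | mid < s * y i x]).
  apply: IH => //.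
  - exact: measurableD.
  - by move=> x [/BA].
  - by move=> x [/KK].
  - move=> x v [Bx /negP /=]; rewrite -leNgt => xa K1v; split.
      by case: K1v => Kv _; exact: combZ.
    apply/negP => /=; rewrite -leNgt mide /mid; have := sy _ K1v; lra.
  - rewrite (le_trans betaB)// mulnS addnC exprD -mulrA.
    by rewrite ler_wpM2l ?exprn_ge0.
have IH2 : Num.sqrt (((1 + t / 2) * (1 - e)) ^+ k * pr D2 * pr K1) <=
    pr (Z `&` [set x | mid < s * y i x]).
  apply: IH => //.
  - exact: measurableI.
  - by move=> x [/BA].
  - by move=> x [/KK].
  - move=> x v [Bx /= xa] K1v; split.
      by case: K1v => Kv _; exact: combZ.
    by rewrite /= mide /mid; have := sy _ K1v; lra.
  - rewrite (le_trans betaB)// mulnS addnC exprD -mulrA.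
    by rewrite ler_wpM2l ?exprn_ge0.
rewrite (prDI P mZ (mpos mid)); apply: le_trans (lerD IH1 IH2).
clear IH IH1 IH2; set g := (1 + t / 2) * (1 - e).
have g0 : 0 <= g by rewrite mulr_ge0//; lra.
have gk : 0 <= g ^+ k by rewrite exprn_ge0.
have gE : g = (1 + t / 2) * (1 - e) by [].
clearbody g.
rewrite !(mulrAC _ _ (pr K1)) !(sqrtrM _ (mulr_ge0 gk (pr_ge0 P K1))) -mulrDr.
rewrite -[leRHS]ger0_norm; last by rewrite mulr_ge0 ?addr_ge0 ?sqrtr_ge0.
rewrite -sqrtr_sqr ler_wsqrtr// [leRHS]exprMn sqr_sqrtr; last first.
  by rewrite mulr_ge0 ?pr_ge0.
apply: (@le_trans _ _ (g ^+ k * pr K1 * ((1 + t / 2) * pr B))); last first.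
  by rewrite ler_wpM2l ?mulr_ge0 ?pr_ge0.
rewrite exprSr -!mulrA ler_wpM2l//.
have -> : g * (pr B * pr K) = (1 - e) * pr K * ((1 + t / 2) * pr B).
  by rewrite gE; ring.
by rewrite ler_wpM2r// mulr_ge0 ?pr_ge0//; lra.
Qed.

End mass_growth.

(** * Definite signs on a set of mass exp(-O(q)) *)

Section spread.
Context (R : realType).

Lemma exists_expn_ge (g M : R) : 1 < g -> exists N : nat, M <= g ^+ N.
Proof.
move=> g1; have lg : 0 < ln g by rewrite ln_gt0.
have M0 : 0 <= `|M| / ln g by rewrite divr_ge0// ltW.
have /andP[_ /ltW] := truncn_itv M0; rewrite ler_pdivrMr//.
set m := (Num.truncn _).+1 => H; exists m.
have -> : g = expR (ln g) by rewrite lnK// posrE; lra.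
rewrite -expRM_natl; apply: le_trans (expR_ge1Dx _).
by have := ler_norm M; lra.
Qed.

Lemma integral_weighted_le d (T : measurableType d) (P : probability T R)
    (n : nat) (b : 'I_n -> R) (h : 'I_n -> T -> R) (D : set T) (u : R) :
  (forall i, 0 <= b i) ->
  (forall i, measurable_fun setT (h i)) -> (forall i x, 0 <= h i x) ->
  measurable D -> (forall i, (\int[P]_(x in D) (h i x)%:E <= u%:E)%E) ->
  (\int[P]_(x in D) (\sum_i b i * h i x)%:E <= ((\sum_i b i) * u)%:E)%E.
Proof.
move=> b0 mh h0 mD hu; under eq_integral do rewrite -sumEFin.
rewrite ge0_integral_sum//; last 2 first.
- move=> i; apply/measurable_EFinP; apply: measurable_funTS.
  exact: measurable_funM.
- by move=> i x _; rewrite lee_fin mulr_ge0.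
rewrite mulr_suml -sumEFin; apply: lee_sum => i _.
under eq_integral do rewrite EFinM.
rewrite ge0_integralZl_EFin//; last 2 first.
- by move=> x _; rewrite lee_fin.
- by apply/measurable_EFinP; exact: measurable_funTS.
by rewrite EFinM lee_wpmul2l// lee_fin.
Qed.

(** The order of choice matters. [c3] lets Markov's inequality lose only [delta / 8]; [z] makes the
    exponential term of [signs_or_gap] small, and [t] the cost of wrong signs; then come [L] and
    finally [kappa], so small that most coordinates stay well below the gap on the typical set. With
    [e = t / 8] the gain [1 + t / 2] of a cut outweighs the loss [1 - e]. *)
Lemma spread_constants (delta c2 : R) : 0 < delta <= 1 -> 1 <= c2 ->
  exists (c3 z t e : R) (L : nat) (kappa : R), [/\ 8 <= c3 /\ c2 = delta / 8 *
    c3,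
    0 < z <= 1 /\ 4 * z * c3 = delta / 256,
    0 < t <= 1 /\ t ^+ 2 = z * (delta / 256),
    [/\ 0 < e, e <= 1 & 2 <= t * L%:R] &
    [/\ 0 < kappa, 2 * kappa * (8 * L%:R) = e * (delta / 16) &
      1 < (1 + t / 2) * (1 - e)]].
Proof.
move=> delta01 c21.
have [u [u0 u1 uE]] : exists u : R, [/\ 0 < u, u <= 1 & u = delta / 256].
  by exists (delta / 256); split; lra.
rewrite -uE; clear uE.
have [c3 c3E] : exists c3 : R, c3 = 8 * c2 / delta by exists (8 * c2 / delta).
have c38 : 8 <= c3 by rewrite c3E ler_pdivlMr; lra.
have c30 : 0 < c3 by lra.
have [z zE] : exists z : R, z = u / (4 * c3) by eexists.
have z0 : 0 < z by rewrite zE; apply: divr_gt0 => //; lra.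
have zc : 4 * z * c3 = u.
  by rewrite zE mulrAC mulrC divfK// gt_eqF// mulr_gt0.
have z1 : z <= 1 by rewrite zE ler_pdivrMr; lra.
have zd : 0 < z * (u) by apply: mulr_gt0.
have [t tE] : exists t : R, t = Num.sqrt (z * u) by eexists.
have t0 : 0 < t by rewrite tE sqrtr_gt0.
have t2 : t ^+ 2 = z * (u) by rewrite tE sqr_sqrtr// ltW.
have t1 : t <= 1.
  rewrite tE -[leRHS]sqrtr1 ler_wsqrtr//.
  by apply: mulr_ile1; lra.
have [L tL] : exists L : nat, 2 <= t * L%:R.
  exists (Num.truncn (2 / t)).+1;
    have t20 : 0 <= 2 / t by rewrite divr_ge0// ltW.
  by have /andP[_ /ltW] := truncn_itv t20; rewrite ler_pdivrMr// mulrC.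
have L0 : 0 < L%:R :> R.
  by rewrite ltr0n lt0n; apply: contraTneq tL => ->; rewrite mulr0 -ltNge.
exists c3, z, t, (t / 8), L, (t / 8 * (delta / 16) / (2 * (8 * L%:R))).
split; split => //.
- by rewrite c3E; field; lra.
- by rewrite z0.
- by rewrite t0.
- by lra.
- by lra.
- by apply: divr_gt0; apply: mulr_gt0 => //; lra.
- by field; rewrite gt_eqF.
have -> : (1 + t / 2) * (1 - t / 8) = 1 + (t / 16) * (6 - t) by field.
by rewrite ltrDl; apply: mulr_gt0; lra.
Qed.

(** Both conditions that define [A1] are pointwise, hence inherited by every subset: the indicators
    average more than [delta / 4] and the exponentials at most [c3]. The first holds on at least
    [delta / 4] of [A], and Markov's inequality with [c2 / c3 = delta / 8] costs half of that. *)
Lemma exists_regular_subset d (T : measurableType d) (P : probability T R)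
    (n : nat) (b : 'I_n -> R) (y : 'I_n -> T -> R) (A : set T)
    (delta c2 c3 : R) :
  (forall i, 0 <= b i) -> \sum_i b i = 1 ->
  (forall i, measurable_fun setT (y i)) -> measurable A ->
  0 < delta -> 0 < c3 -> c2 = delta / 8 * c3 ->
  (forall i, (\int[P]_(x in A) (expR `|y i x|)%:E <= (c2 * pr P A)%:E)%E) ->
  delta / 2 * pr P A <= \sum_i b i * pr P (A `&` [set x | 2^-1 < `|y i x|]) ->
  exists A1 : set T, [/\ measurable A1, delta / 8 * pr P A <= pr P A1,
    (forall B, measurable B -> B `<=` A1 -> delta / 4 * pr P B <=
       \sum_i b i * pr P (B `&` [set x | 2^-1 < `|y i x|])) &
    forall x, A1 x -> \sum_i b i * expR `|y i x| <= c3].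
Proof.
move=> b0 b1 my mA d0 c30 c3E expy halfy.
pose E i := [set x | 2^-1 < `|y i x|].
have mabs i : measurable_fun setT (fun x => `|y i x|).
  exact: measurableT_comp.
have mE i : measurable (E i) by exact: measurable_gt.
pose H x := \sum_i b i * \1_(E i) x.
pose V x := \sum_i b i * expR `|y i x|.
have mH : measurable_fun setT H.
  by apply: measurable_sum => i; exact: measurable_funM.
have mV : measurable_fun setT V.
  apply: measurable_sum => i; apply: measurable_funM => //.
  by apply: measurableT_comp.
have V0 x : 0 <= V x by apply: sumr_ge0 => i _; rewrite mulr_ge0 ?expR_ge0.
have mSH : measurable [set x | delta / 4 < H x] by exact: measurable_gt.
have mSV : measurable [set x | c3 < V x] by exact: measurable_gt.
pose AH := A `&` [set x | delta / 4 < H x].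
pose AL := A `\` [set x | delta / 4 < H x].
have mAH : measurable AH by exact: measurableI.
have mAL : measurable AL by exact: measurableD.
have d4 : 0 <= delta / 4 by rewrite divr_ge0// ltW.
have pAH : delta / 4 * pr P A <= pr P AH.
  have h1 : \sum_i b i * pr P (AH `&` E i) <= 1 * pr P AH.
    apply: sum_pr_le => // x _; rewrite -b1; apply: ler_sum => i _.
    by rewrite indicE ler_piMr// lern1 leq_b1.
  have h2 : \sum_i b i * pr P (AL `&` E i) <= delta / 4 * pr P AL.
    by apply: sum_pr_le => // x [_ /negP]; rewrite -leNgt.
  have h3 : \sum_i b i * pr P (A `&` E i) = \sum_i b i * pr P (AH `&` E i) +
      \sum_i b i * pr P (AL `&` E i).
    rewrite -big_split; apply: eq_bigr => i _ /=; rewrite -mulrDr.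
    rewrite (@prDI _ _ _ P (A `&` E i) _ _ mSH); last exact: measurableI.
    by rewrite /AL /AH addrC setIDAC setIDA (setIAC A (E i)).
  have h4 : delta / 4 * pr P AL <= delta / 4 * pr P A.
    by rewrite ler_wpM2l//; apply: le_pr => // x [].
  rewrite -/E h3 in halfy.
  by clear -h1 h2 halfy h4; lra.
have h1 : (\int[P]_(x in A) (V x)%:E <= (c2 * pr P A)%:E)%E.
  rewrite -[c2 * _]mul1r -b1.
  by apply: integral_weighted_le => // i; exact: measurableT_comp.
have := le_trans (le_mul_pr_integral P mA mV V0 (ltW c30)) h1.
rewrite lee_fin => h2.
have h3 : pr P (A `&` [set x | c3 < V x]) <= delta / 8 * pr P A.
  rewrite -(ler_pM2l c30); apply: (le_trans h2).
  by rewrite mulrA ler_wpM2r ?pr_ge0// c3E [leRHS]mulrC.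
have h4 : pr P (AH `&` [set x | c3 < V x]) <= pr P (A `&` [set x | c3 < V x]).
  by apply: le_pr; [exact: measurableI|exact: measurableI|move=> x [[]]].
exists (AH `\` [set x | c3 < V x]); split.
- exact: measurableD.
- by have := prDI P mAH mSV; clear -h3 h4 pAH; lra.
- move=> B mB BA; rewrite -lee_fin -integral_weighted_indic//.
  rewrite EFinM -prE// -(integral_cst _ mB); apply: ge0_le_integral => //.
  + by apply/measurable_EFinP; exact: measurable_funTS.
  + by move=> x /BA[[_ /= /ltW]]; rewrite lee_fin.
- by move=> x [_ /negP]; rewrite -leNgt.
Qed.

Lemma exists_typical_set d (T : measurableType d) (P : probability T R)
    (h : T -> R) (kappa : R) :
  measurable_fun setT h -> (forall x, 0 <= h x) -> 0 < kappa ->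
  (\int[P]_x (h x)%:E <= kappa%:E)%E ->
  exists K : set T, [/\ measurable K, 2^-1 <= pr P K &
    forall x, K x -> h x <= 2 * kappa].
Proof.
move=> mh h0 k0 hk; exists (~` [set x | 2 * kappa < h x]); split.
- by apply: measurableC; exact: measurable_gt.
- have k20 : 0 <= 2 * kappa by rewrite mulr_ge0// ltW.
  have := le_trans (le_mul_pr_integral P measurableT mh h0 k20) hk.
  rewrite lee_fin mulrAC ger_pMl// => h1.
  have := prDI P measurableT (measurable_gt (2 * kappa) mh).
  by rewrite prT setTD; clear -h1; lra.
- by move=> x /negP; rewrite -leNgt.
Qed.

(** There are at most [2 * N * q] cuts, each keeping the proportion [t ^+ 2], so the remaining mass
    is still exponential in [- q]. The division by 2 is the loss in [signs_or_gap]. *)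
Lemma spread_mass_bound (delta t q pA pA1 : R) (N m : nat) :
  0 < delta -> 0 < t -> ln t <= 0 -> ln (delta / 16) <= 0 ->
  1 <= q -> m%:R <= 2 * q -> expR (- (2 * q)) <= pA ->
  delta / 8 * pA <= pA1 ->
  expR (- ((4 * N%:R * (- ln t) - ln (delta / 16) + 2) * q)) <=
    t ^+ (2 * (N * m)) * pA1 / 2.
Proof.
move=> d0 t0 lnt lnd q1 mq hA hA1.
have h1 : expR (- (4 * N%:R * (- ln t) * q)) <= t ^+ (2 * (N * m)).
  rewrite -{2}(@lnK _ t)// -expRM_natl ler_expR !natrM.
  have : 2 * (N%:R * m%:R) * (- ln t) <= 4 * N%:R * (- ln t) * q.
    rewrite [leRHS](_ : _ = 2 * (N%:R * (2 * q)) * (- ln t)); last by ring.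
    by rewrite ler_wpM2r ?oppr_ge0// ler_wpM2l// ler_wpM2l.
  clear; lra.
have h2 : expR (q * ln (delta / 16) - 2 * q) <= pA1 / 2.
  rewrite expRD; apply: (@le_trans _ _ (delta / 16 * pA)); last first.
    by clear -hA1; lra.
  apply: ler_pM; rewrite ?expR_ge0//.
  have d16 : 0 < delta / 16 by rewrite divr_gt0.
  rewrite -[leRHS](lnK d16) ler_expR.
  by move: (ln _) lnd => l l0; rewrite ler_neMl.
have -> : - ((4 * N%:R * (- ln t) - ln (delta / 16) + 2) * q) =
    - (4 * N%:R * (- ln t) * q) + (q * ln (delta / 16) - 2 * q) by ring.
by rewrite expRD -[leRHS]mulrA ler_pM// expR_ge0.
Qed.

(** The constant [32 / delta] pays for the factors [delta / 8] and 1/2 and leaves 2. *)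
Lemma spread_mass_gt1 (delta q G pA pA1 pK : R) :
  0 < delta -> 32 / delta * expR (2 * q) <= G -> expR (- (2 * q)) <= pA ->
  delta / 8 * pA <= pA1 -> 2^-1 <= pK -> 1 < G * pA1 * pK.
Proof.
move=> d0 hG hA hA1 hK.
have d8 : 0 <= delta / 8 by rewrite divr_ge0// ltW.
have h1 : 32 / delta * expR (2 * q) * (delta / 8 * expR (- (2 * q))) = 4.
  by rewrite expRN; field; rewrite !gt_eqF ?expR_gt0.
have h2 : 4 <= G * pA1.
  rewrite -h1; apply: ler_pM => //.
  - by rewrite mulr_ge0 ?expR_ge0// divr_ge0// ltW.
  - by rewrite mulr_ge0 ?expR_ge0.
  - by apply: le_trans hA1; rewrite ler_wpM2l.
apply: (@lt_le_trans _ _ (4 * 2^-1)); first by clear; lra.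
by apply: ler_pM => //; rewrite invr_ge0.
Qed.

(** By contradiction: without such a [B], [signs_or_gap] finds a gap in every subset of [A1] of mass
    at least [beta]. Then [mass_growth] runs for a number of steps of order [q] and gives the
    midpoints of [A1] and [K0] a mass above 1. *)
Theorem spread (delta c2 : R) : 0 < delta <= 1 -> 1 <= c2 ->
  exists kappa c C : R, [/\ 0 < kappa, 0 < c, 0 < C &
  forall d (T : measurableType d) (P : probability T R)
    (comb : R -> T -> T -> T) (n : nat) (b : 'I_n -> R) (y : 'I_n -> T -> R)
    (A : set T) (q : R),
    brunn_minkowski P comb ->
    (forall i, 0 <= b i) -> \sum_i b i = 1 ->
    (forall i, measurable_fun setT (y i)) ->
    (forall i, comb_affine comb (y i)) ->
    measurable A -> 1 <= q -> expR (- (2 * q)) <= pr P A ->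
    (forall i, (\int[P]_(x in A) (expR `|y i x|)%:E <= (c2 * pr P A)%:E)%E) ->
    delta / 2 * pr P A <= \sum_i b i * pr P (A `&` [set x | 2^-1 < `|y i x|]) ->
    (\int[P]_x (\sum_i b i * `|y i x|)%:E <= kappa%:E)%E ->
    exists (eps : 'I_n -> R) (B : set T), [/\ forall i, `|eps i| <= 1,
      measurable B, expR (- (C * q)) <= pr P B &
      forall x, B x -> c <= \sum_i b i * (eps i * y i x)]].
Proof.
move=> delta01 c21.
have [c3 [z [t [e [L [kappa [[c38 c3E] [z01 zc] [t01 tE] [e0 e1 tL]
  [kappa0 kappaE g1]]]]]]]] := spread_constants delta01 c21.
have [t0 t1] : 0 < t /\ t <= 1 by case/andP: t01.
have [d0 d1] : 0 < delta /\ delta <= 1 by case/andP: delta01.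
have c30 : 0 < c3 by apply: lt_le_trans c38.
set g := (1 + t / 2) * (1 - e) in g1.
(* [N] cuts compensate one unit of [q] in the bound [expR (- (2 * q))] on the mass of [A]. *)
have [N gN] := exists_expn_ge (32 / delta * expR 2) g1.
have d32 : 1 <= 32 / delta by rewrite ler_pdivlMr// mul1r (le_trans d1)// ler1n.
have growth q m : q <= m.+1%:R ->
    32 / delta * expR (2 * q) <= (g ^+ N) ^+ m.+1.
  move=> qm; apply: (@le_trans _ _ ((32 / delta * expR 2) ^+ m.+1)).
    rewrite exprMn -expRM_natl; apply: ler_pM;
      rewrite ?expR_ge0 ?(le_trans ler01)//.
    - by rewrite ler_eXnr.
    - by rewrite ler_expR mulrC ler_wpM2r.
  have d320 : 0 <= 32 / delta * expR 2.
    by rewrite mulr_ge0 ?expR_ge0// (le_trans ler01).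
  by rewrite lerXn2r ?nnegrE// (le_trans d320).
pose C := 4 * N%:R * (- ln t) - ln (delta / 16) + 2.
have lnt : ln t <= 0 by rewrite -ln1 ler_ln ?posrE.
have d16 : 0 < delta / 16 by rewrite divr_gt0.
have lnd : ln (delta / 16) <= 0.
  by rewrite -ln1 ler_ln ?posrE//; clear -d1; lra.
have C0 : 0 < C.
  have : 0 <= 4 * N%:R * (- ln t) by rewrite mulr_ge0 ?mulr_ge0// oppr_ge0.
  by rewrite /C; clear -lnd; lra.
have c0 : 0 < delta / 128 by rewrite divr_gt0.
exists kappa, (delta / 128), C; split => //.
move=> d T P comb n b y A q BM b0 b1 my ay mA q1 pA expy halfy meany.
apply: contrapT => nospread.
have [m [mq qm]] : exists m, m.+1%:R <= 2 * q /\ q <= m.+1%:R.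
  have q0 : 0 <= q by apply: le_trans q1.
  exists (Num.truncn q); have /andP[h1 h2] := truncn_itv q0.
  by split; [rewrite -addn1 natrD; clear -h1 q1; lra|exact: ltW].
have [A1 [mA1 pA1 largeA1 regA1]] :=
  exists_regular_subset b0 b1 my mA d0 c30 c3E expy halfy.
have mN : measurable_fun setT (fun x => \sum_i b i * `|y i x|).
  by apply: measurable_sum => i; apply: measurable_funM => //;
    exact: measurableT_comp.
have N00 x : 0 <= \sum_i b i * `|y i x|.
  by apply: sumr_ge0 => i _; rewrite mulr_ge0.
have [K0 [mK0 pK0 typK0]] := exists_typical_set mN N00 kappa0 meany.
pose k := (N * m.+1)%N.
pose beta := t ^+ (2 * k) * pr P A1.
have betaC := spread_mass_bound N d0 t0 lnt lnd q1 mq pA pA1.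
rewrite -/k -/C -/beta in betaC.
have pA10 : 0 < pr P A1.
  apply: lt_le_trans pA1; rewrite mulr_gt0 ?divr_gt0//.
  by apply: lt_le_trans pA; exact: expR_gt0.
have e01 : 0 <= e <= 1 by rewrite ltW.
have [zc' tE' kE'] : [/\ 4 * z * c3 <= delta / 256,
    t ^+ 2 <= z * (delta / 256) & 2 * kappa * (8 * L%:R) <= e * (delta / 16)].
  by rewrite zc tE kappaE !lexx.
have gap B K : measurable B -> measurable K -> B `<=` A1 -> K `<=` K0 ->
    beta <= pr P B -> 0 < pr P K ->
    exists i s a, gap_along P y K B e t L i s a.
  move=> mB mK BA KK betaB pK.
  have pB : 0 < pr P B.
    by apply: lt_le_trans betaB; rewrite mulr_gt0// exprn_gt0.
  have vB x : B x -> \sum_i b i * expR `|y i x| <= c3 by move/BA/regA1.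
  have hK x : K x -> \sum_i b i * `|y i x| <= 2 * kappa by move/KK/typK0.
  have [[eps [B' [epsl mB' BB pB' low]]]|//] := signs_or_gap b0 b1 my mB mK pB
    pK delta01 z01 zc' t01 tE' e0 tL kE' (largeA1 _ mB BA) vB hK.
  exfalso; apply: nospread; exists eps, B'; split => //.
  apply: (le_trans betaC); apply: le_trans pB'.
  by rewrite ler_pM2r ?invr_gt0.
have := @mass_growth R d T P comb n y A1 K0 e t beta L BM my ay t01 e01 gap k
  A1 K0 setT mA1 mK0 measurableT (fun x h => h) (fun x h => h)
  (fun _ _ _ _ => I) (lexx _).
have gk0 : 0 <= g ^+ k by rewrite exprn_ge0// (le_trans _ (ltW g1)).
rewrite -/g prT -[leRHS]sqrtr1 ler_psqrt ?nnegrE//; last first.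
  by rewrite !mulr_ge0 ?pr_ge0.
apply/negP; rewrite -ltNge; apply: (spread_mass_gt1 d0 _ pA pA1 pK0).
by rewrite /k exprM; exact: growth.
Qed.

End spread.

(** * Tail of the norm *)

Section norm_tail.
Context (R : realType).

Lemma measurable_fun_powR d (T : measurableType d) (h : T -> R) (r : R) :
  measurable_fun setT h -> measurable_fun setT (fun x => h x `^ r).
Proof. by move=> mh; exact: (measurableT_comp (@measurable_powR R r) mh). Qed.

Lemma measurable_power_sum d (T : measurableType d) n (f : 'I_n -> T -> R)
    (r : R) : (forall i, measurable_fun setT (f i)) ->
  measurable_fun setT (fun x => \sum_i `|f i x| `^ r).
Proof.
move=> mf; apply: measurable_sum => i; apply: measurable_fun_powR.
exact: measurableT_comp.
Qed.

Lemma ge0_integral_scale d (T : measurableType d) (P : probability T R)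
    (h : T -> R) (c : R) : 0 <= c -> measurable_fun setT h ->
  (forall x, 0 <= h x) ->
  (\int[P]_x (c * h x)%:E = c%:E * \int[P]_x (h x)%:E)%E.
Proof.
move=> c0 mh h0; under eq_integral do rewrite EFinM.
rewrite ge0_integralZl_EFin//; first by move=> x _; rewrite lee_fin.
exact/measurable_EFinP.
Qed.

(** Borell's lemma will be used with [b = 8]: the resulting tail [expR (- (4 * k.+1%:R))] is so fast
    that even its square root meets the hypothesis of [exponential_moment] at [a = 1]. *)
Lemma borell_constant : expR (- 9) <= expR (- 8) * (1 - expR (- 9)) :> R.
Proof.
have h1 : expR (- 1) <= 2^-1 :> R.
  by rewrite expRN lef_pV2 ?posrE ?expR_gt0// expR1_ge2.
have -> : - 9 = - 8 + - 1 :> R by ring.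
have h2 : expR (- 8 + - 1) <= expR (- 1) :> R by rewrite ler_expR; lra.
by rewrite {1}expRD ler_wpM2l ?expR_ge0//; lra.
Qed.

(* Borell's lemma gives exponential tails at the scale of any quantile. *)
Lemma quantile_exp_tail d (T : measurableType d) (P : probability T R)
    (comb : R -> T -> T -> T) (f : T -> R) (A : set T) (M : R) :
  brunn_minkowski P comb -> measurable_fun setT f -> comb_affine comb f ->
  measurable A -> comb_convex comb A -> 0 <= M ->
  pr P (A `&` [set x | M < `|f x|]) <= expR (- 9) * pr P A ->
  forall k, (0 < k)%N -> pr P (A `&` [set x | k%:R * M < `|f x|]) <=
    expR (- (4 * k.+1%:R)) * pr P A.
Proof.
move=> BM mf af mA cA M0 hM k k0.
have mh : measurable_fun setT (fun x => `|f x|) by exact: measurableT_comp.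
have b8 : 0 <= 8 :> R by [].
have := borell BM mA cA mh (affine_reverse_triangle af) M0 b8 (expR_ge0 _)
  borell_constant hM k0.
by have -> : 8 * k.+1%:R / 2 = 4 * k.+1%:R :> R by field.
Qed.

(** Divide each coordinate by its quantile and weight it by its share of the sum of the M_i^r. If
    that sum were large, [spread] would apply, and its signs would give a functional with too large
    a p-th moment. The condition on [c] expresses norm at most 1 in the dual of l_r^n without the
    conjugate exponent, so it covers [r = 1] too. *)
Lemma quantile_sum_lt : exists Lam : R, 2 <= Lam /\
  forall d (T : measurableType d) (P : probability T R)
    (comb : R -> T -> T -> T) (n : nat) (f : 'I_n -> T -> R) (r p s : R)
    (A : set T) (M : 'I_n -> R),
    brunn_minkowski P comb ->
    (forall i, measurable_fun setT (f i)) -> (forall i, comb_affine comb (f i))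
      ->
    1 <= r -> 1 <= p -> 0 < s ->
    (forall c : 'I_n -> R,
      (forall v : 'I_n -> R, `|\sum_i c i * v i| `^ r <= \sum_i `|v i| `^ r) ->
      (\int[P]_x (`|\sum_i c i * f i x| `^ p)%:E <= (s `^ p)%:E)%E) ->
    (\int[P]_x ((\sum_i `|f i x| `^ r) `^ r^-1)%:E <= s%:E)%E ->
    measurable A -> comb_convex comb A -> expR (- (2 * (5 * p))) <= pr P A ->
    (forall i, [/\ s / n.+1%:R <= M i,
      pr P (A `&` [set x | M i < `|f i x|]) <= expR (- 9) * pr P A &
      M i = s / n.+1%:R \/
      expR (- 9) * pr P A < pr P (A `&` [set x | M i / 2 < `|f i x|])]) ->
    \sum_i M i `^ r < (Lam * s) `^ r.
Proof.
have delta01 : 0 < expR (- 9 : R) <= 1.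
  by rewrite expR_gt0 expR_le1; lra.
have c21 : 1 <= expR 1 + 1 :> R by have := @expR_gt0 R 1; lra.
have [kappa [c [C [kappa0 c0 C0 spr]]]] := spread delta01 c21.
(* One term per purpose: quantiles equal to the floor [s / n.+1%:R] carry at most half of the
   weight; the mean required by [spread] is at most [kappa]; the final functional contradicts the
   weak moment. *)
pose Lam := 2 + kappa^-1 + 2 * expR (5 * C) / c.
have ki0 : 0 < kappa^-1 by rewrite invr_gt0.
have ci0 : 0 < 2 * expR (5 * C) / c by rewrite divr_gt0 ?mulr_gt0 ?expR_gt0.
have Lam2 : 2 <= Lam by rewrite /Lam; lra.
exists Lam; split=> // d T P comb n f r p s A M BM mf af r1 p1 s0 weak mean.
move=> mA cA pA hM; rewrite ltNge; apply/negP => SLam.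
have r0 : 0 < r by clear -r1; lra.
have n0 : 0 < n.+1%:R :> R by rewrite ltr0n.
have M0 i : 0 < M i by have [h _ _] := hM i; apply: lt_le_trans h;
  rewrite divr_gt0.
set S := \sum_i M i `^ r in SLam.
have Ls0 : 0 < Lam * s by rewrite mulr_gt0//; lra.
have S0 : 0 < S by apply: lt_le_trans SLam; rewrite powR_gt0.
pose s' := S `^ r^-1.
have s'0 : 0 < s' by rewrite powR_gt0.
have s'S : s' `^ r = S by rewrite -powRrM mulVf ?gt_eqF// powRr1// ltW.
have Ls' : Lam * s <= s'.
  rewrite leNgt; apply/negP => H; move: SLam; apply/negP; rewrite -ltNge -s'S.
  by apply: gt0_ltr_powR; rewrite ?nnegrE ?(ltW s'0) ?(ltW Ls0).
pose b i := M i `^ r / S.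
pose y i x := (M i)^-1 * f i x.
have b0 i : 0 <= b i by rewrite divr_ge0 ?powR_ge0// ltW.
have b1 : \sum_i b i = 1 by rewrite -mulr_suml divff// gt_eqF.
have my i : measurable_fun setT (y i) by exact: measurable_funM.
have mabsy i : measurable_fun setT (fun x =>
  `|y i x|) by exact: measurableT_comp.
have ay i : comb_affine comb (y i) by move=> l x v l01; rewrite /y af//; ring.
have yE i x (u : R) : (u < `|y i x|) = (u * M i < `|f i x|).
  by rewrite normrM gtr0_norm ?invr_gt0// mulrC ltr_pdivlMr.
have pA0 : 0 < pr P A by apply: lt_le_trans pA; exact: expR_gt0.
have expy i : (\int[P]_(x in A) (expR `|y i x|)%:E <=
    ((expR 1 + 1) * pr P A)%:E)%E.
  have one1 : 1 <= 1 :> R by [].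
  have := @exponential_moment R d T P 1 (pr P A) A (fun x => `|y i x|) one1
    (pr_ge0 P A) mA (mabsy i)
    (fun x => normr_ge0 _).
  under eq_integral do rewrite mul1r.
  rewrite -[X in _ + X]mul1r -mulrDl; apply => k k0.
  have -> : [set x | k%:R < `|y i x|] = [set x | k%:R * M i < `|f i x|].
    by apply/seteqP; split => x /=; rewrite yE.
  have [_ hMi _] := hM i.
  apply: le_trans (quantile_exp_tail BM (mf i) (af i) mA cA (ltW (M0 i)) hMi
    k0) _.
  rewrite mulrC ler_wpM2l ?pr_ge0// ler_expR.
  by have k1 : 0 <= k.+1%:R :> R by []; clear -k1; lra.
have halfy : expR (- 9) / 2 * pr P A <=
    \sum_i b i * pr P (A `&` [set x | 2^-1 < `|y i x|]).
  pose small i := M i == s / n.+1%:R.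
  have wsmall : \sum_(i | small i) b i <= 2^-1.
    apply: (@le_trans _ _ (\sum_(i < n) (s / n.+1%:R) `^ r / S)).
      rewrite [leRHS](bigID small)/=.
      rewrite -[leLHS]addr0 lerD//; last first.
        by apply: sumr_ge0 => i _; rewrite divr_ge0 ?powR_ge0// ltW.
      by apply: ler_sum => i /eqP Mi; rewrite /b Mi.
    rewrite sumr_const card_ord -[leLHS]mulr_natr mulrAC ler_pdivrMr//.
    apply: (@le_trans _ _ (s `^ r)).
      rewrite powRM ?invr_ge0 ?(ltW s0)// -mulrA ler_piMr ?powR_ge0//.
      apply: (@le_trans _ _ (n.+1%:R^-1 * n%:R)).
        rewrite ler_wpM2r// ge1r_powR// invr_gt0 n0/= invf_le1// ler1n//.
      by rewrite mulrC ler_pdivrMr// mul1r ler_nat.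
    have : 2 * s `^ r <= S.
      apply: le_trans SLam; rewrite powRM//; [|lra|exact: ltW].
      rewrite ler_wpM2r ?powR_ge0// (le_trans Lam2)// le1r_powR//; lra.
    lra.
  rewrite (bigID small)/=; apply: (@le_trans _ _
      (\sum_(i | ~~ small i) b i * (expR (- 9) * pr P A))).
    rewrite -mulr_suml; have : \sum_(i | small i) b i + \sum_(i | ~~ small i) b
      i = 1.
      by rewrite -b1 [RHS](bigID small).
    move=> sb; rewrite -mulrA mulrCA ler_wpM2r ?mulr_ge0 ?expR_ge0 ?(ltW pA0)//.
    lra.
  rewrite -[leLHS]add0r lerD//.
    by apply: sumr_ge0 => i _; rewrite mulr_ge0 ?pr_ge0.
  apply: ler_sum => i /eqP nsm; rewrite ler_wpM2l//.
  have [_ _ [//|/ltW]] := hM i.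
  have -> // : [set x | M i / 2 < `|f i x|] = [set x | 2^-1 < `|y i x|].
  by apply/seteqP; split => x /=; rewrite yE mulrC.
(* [s'] is the l_r norm of [M]. This one estimate yields both the bound on the mean and the dual
   norm of [w]. *)
have wmean (v : 'I_n -> R) :
    \sum_i b i * (`|v i| / M i) <= (\sum_i `|v i| `^ r) `^ r^-1 / s'.
  have vM i : 0 <= `|v i| / M i by rewrite divr_ge0// ltW.
  have := power_mean r1 b0 b1 vM.
  have -> : \sum_i b i * (`|v i| / M i) `^ r = (\sum_i `|v i| `^ r) / S.
    rewrite mulr_suml; apply: eq_bigr => i _.
    rewrite powRM ?invr_ge0 ?(ltW (M0 i))// -powR_inv1 ?(ltW (M0 i))//.
    rewrite -powRrM mulN1r powRN /b; field.
    by rewrite !gt_eqF ?powR_gt0.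
  set w := \sum_i b i * _ => wr.
  have w0 : 0 <= w by apply: sumr_ge0 => i _; rewrite mulr_ge0.
  have V0 : 0 <= \sum_i `|v i| `^ r by apply: sumr_ge0 => i _; exact: powR_ge0.
  have -> : w = (w `^ r) `^ r^-1 by rewrite -powRrM mulfV ?gt_eqF// powRr1.
  apply: (@le_trans _ _ (((\sum_i `|v i| `^ r) / S) `^ r^-1)).
    by apply: ge0_ler_powR;
      rewrite ?nnegrE ?powR_ge0 ?divr_ge0 ?invr_ge0 ?(ltW r0) ?(ltW S0).
  rewrite powRM ?invr_ge0 ?(ltW S0)// -[S^-1]powR_inv1 ?(ltW S0)//.
  by rewrite -powRrM mulN1r powRN.
have meany : (\int[P]_x (\sum_i b i * `|y i x|)%:E <= kappa%:E)%E.
  apply: (@le_trans _ _ (\int[P]_x (s'^-1 *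
      (\sum_i `|f i x| `^ r) `^ r^-1)%:E)%E).
    apply: ge0_le_integral => //.
    - by move=> x _; rewrite lee_fin sumr_ge0// => i _; rewrite mulr_ge0.
    - apply/measurable_EFinP; apply: measurable_sum => i.
      by apply: measurable_funM => //; exact: measurableT_comp.
    - apply/measurable_EFinP; apply: measurable_funM => //.
      by apply: measurable_fun_powR; exact: measurable_power_sum.
    move=> x _; rewrite lee_fin mulrC; apply: le_trans (wmean (f^~ x)).
    apply: ler_sum => i _; rewrite ler_wpM2l// normrM gtr0_norm ?invr_gt0//.
    by rewrite mulrC.
  rewrite ge0_integral_scale; last 3 first.
  - by rewrite invr_ge0 ltW.
  - by apply: measurable_fun_powR; exact: measurable_power_sum.
  - by move=> x; exact: powR_ge0.
  apply: (@le_trans _ _ (s'^-1%:E * s%:E)%E).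
    by rewrite lee_wpmul2l// lee_fin invr_ge0 ltW.
  rewrite -EFinM lee_fin mulrC ler_pdivrMr//.
  apply: (@le_trans _ _ (kappa * (Lam * s))); last by rewrite ler_wpM2l// ltW.
  rewrite mulrA ler_peMl ?(ltW s0)// /Lam !mulrDr mulfV ?gt_eqF//.
  have h1 : 0 < kappa * 2 by rewrite mulr_gt0.
  have h2 : 0 < kappa * (2 * expR (5 * C) / c) by rewrite mulr_gt0.
  by clear -h1 h2; lra.
have q1 : 1 <= 5 * p by clear -p1; lra.
have [eps [B [eps1 mB pB lowB]]] := spr d T P comb n b y A (5 * p) BM b0 b1 my
  ay
  mA q1 pA expy halfy meany.
(* Up to the signs [eps], this is the functional of norm 1 on l_r^n that attains the norm [s'] of
   [M]. *)
pose w i := s' * (b i * (eps i / M i)).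
have w_le (v : 'I_n -> R) i : `|w i * v i| <= s' * (b i * (`|v i| / M i)).
  rewrite (normrM (w i)) (normrM s') (normrM (b i)) (normrM (eps i)) normfV.
  rewrite (gtr0_norm s'0) (ger0_norm (b0 i)) (gtr0_norm (M0 i)).
  have -> : s' * (b i * (`|eps i| / M i)) * `|v i| =
      `|eps i| * (s' * (b i * (`|v i| / M i))) by ring.
  rewrite ler_piMl//; apply: mulr_ge0; first exact: ltW.
  by apply: mulr_ge0 => //; apply: divr_ge0 => //; exact: ltW.
have dualw (v : 'I_n -> R) : `|\sum_i w i * v i| `^ r <= \sum_i `|v i| `^ r.
  have V0 : 0 <= \sum_i `|v i| `^ r by apply: sumr_ge0 => i _; exact: powR_ge0.
  have : `|\sum_i w i * v i| <= (\sum_i `|v i| `^ r) `^ r^-1.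
    apply: (le_trans (ler_norm_sum _ _ _)).
    apply: (@le_trans _ _ (\sum_i s' * (b i * (`|v i| / M i)))).
      by apply: ler_sum => i _; exact: w_le.
    by rewrite -mulr_sumr mulrC -ler_pdivlMr.
  move=> H; apply: (@le_trans _ _ (((\sum_i `|v i| `^ r) `^ r^-1) `^ r)).
    by apply: ge0_ler_powR; rewrite ?nnegrE ?powR_ge0 ?(ltW r0).
  by rewrite -powRrM mulVf ?gt_eqF// powRr1.
have := weak w dualw.
pose h x := `|\sum_i w i * f i x| `^ p.
have mh : measurable_fun setT h.
  apply: measurable_fun_powR; apply: measurableT_comp => //.
  by apply: measurable_sum => i; exact: measurable_funM.
(* The functional is at least [s' * c] on [B]; half of this makes room for the strict inequality in
   [le_mul_pr_integral]. *)
have u0 : 0 <= (s' * c / 2) `^ p by exact: powR_ge0.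
have := le_mul_pr_integral P measurableT mh (fun x => powR_ge0 _ _) u0.
move=> H1 H2; have := le_trans H1 H2; rewrite setTI lee_fin => {H1 H2} H.
have pp0 : 0 < p by clear -p1; lra.
have Bsub : pr P B <= pr P [set x | (s' * c / 2) `^ p < h x].
  apply: le_pr => //; first exact: measurable_gt.
  move=> x /lowB Bx /=; apply: gt0_ltr_powR; rewrite ?nnegrE//.
    by rewrite !mulr_ge0// ltW.
  apply: lt_le_trans (ler_norm _).
  have -> : \sum_i w i * f i x = s' * \sum_i b i * (eps i * y i x).
    by rewrite mulr_sumr; apply: eq_bigr => i _; rewrite /w /y; ring.
  by rewrite -mulrA ltr_pM2l//; clear -c0 Bx; lra.
have : (s' * c / 2) `^ p * expR (- (C * (5 * p))) <= s `^ p.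
  apply: le_trans H; rewrite ler_wpM2l//; exact: le_trans Bsub.
have -> : - (C * (5 * p)) = - (5 * C) * p by ring.
rewrite expRM -powRM ?expR_ge0//; last by rewrite !mulr_ge0// ltW.
apply/negP; rewrite -ltNge; apply: gt0_ltr_powR; rewrite ?nnegrE ?(ltW s0)//.
  by rewrite !mulr_ge0 ?expR_ge0// ltW.
rewrite expRN ltr_pdivlMr ?expR_gt0//.
have : 2 * expR (5 * C) / c * s < s'.
  by apply: lt_le_trans Ls'; rewrite ltr_pM2r// /Lam; clear -ki0; lra.
by rewrite mulrAC ltr_pdivrMr// => H'; clear -H'; lra.
Qed.

End norm_tail.

(** * Greedy half-space cuts and the tail of the norm *)

Section strong_tail.
Context (R : realType).

Section halfspaces.
Context d (T : measurableType d) (P : probability T R).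
Context (comb : R -> T -> T -> T).
Local Notation pr := (pr P).

Lemma comb_convex_halfspace (A : set T) (f : T -> R) (e u : R) :
  comb_affine comb f -> comb_convex comb A ->
  comb_convex comb (A `&` [set x | u < e * f x]).
Proof.
move=> af cA l x v l01 [Ax /= ux] [Av /= uv]; split; first exact: cA.
rewrite /= af//.
have -> : e * (l * f x + (1 - l) * f v) = l * (e * f x) + (1 - l) * (e * f v).
  by ring.
have -> : u = l * u + (1 - l) * u by ring.
by apply: ltrD; rewrite ltr_pM2l//; lra.
Qed.

(* If no half-space cut of [A] improves the ratio of the mass of [G] to the
   square root of the mass of [A], then [G] inherits exponential tails. *)
Lemma no_gain_exp_tail (A G : set T) (f : T -> R) (M : R) :
  brunn_minkowski P comb -> measurable_fun setT f -> comb_affine comb f ->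
  measurable A -> comb_convex comb A -> measurable G -> 0 <= M ->
  pr (A `&` [set x | M < `|f x|]) <= expR (- 9) * pr A ->
  (forall e u, e = 1 \/ e = -1 ->
    pr (G `&` (A `&` [set x | u < e * f x])) * Num.sqrt (pr A) <=
    2 * Num.sqrt (pr (A `&` [set x | u < e * f x])) * pr (G `&` A)) ->
  0 < pr A ->
  forall k, (0 < k)%N ->
  pr ((G `&` A) `&` [set x | k%:R * M < `|f x|]) <=
  4 * pr (G `&` A) * expR (- (2 * 1 * k.+1%:R)).
Proof.
move=> BM mf af mA cA mG M0 hM nogain pA k k0.
have mpos (e u : R) : measurable (A `&` [set x | u < e * f x]).
  by apply: measurableI => //; apply: measurable_gt; exact: measurable_funM.
have mabs (u : R) : measurable [set x | u < `|f x|].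
  by apply: measurable_gt; exact: measurableT_comp.
have side (e : R) : e = 1 \/ e = -1 ->
    pr (G `&` (A `&` [set x | k%:R * M < e * f x])) <=
    2 * pr (G `&` A) * expR (- (2 * 1 * k.+1%:R)).
  move=> e1; have sA : 0 < Num.sqrt (pr A) by rewrite sqrtr_gt0.
  rewrite -(ler_pM2r sA); apply: (le_trans (nogain _ _ e1)).
  have -> : 2 * pr (G `&` A) * expR (- (2 * 1 * k.+1%:R)) * Num.sqrt (pr A) =
    2 * (expR (- (2 * 1 * k.+1%:R)) * Num.sqrt (pr A)) * pr (G `&` A) by ring.
  rewrite ler_wpM2r ?pr_ge0// ler_wpM2l//.
  (* The square root of the mass in [nogain] halves the rate 4 of the quantile tail. *)
  have -> : expR (- (2 * 1 * k.+1%:R)) = Num.sqrt (expR (- (4 * k.+1%:R))) :> R.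
    have -> : - (4 * k.+1%:R) = 2%:R * (- (2 * 1 * k.+1%:R)) :> R by ring.
    by rewrite expRM_natl sqrtr_sqr ger0_norm ?expR_ge0.
  rewrite -sqrtrM ?expR_ge0// ler_wsqrtr//.
  apply: le_trans (quantile_exp_tail BM mf af mA cA M0 hM k0).
  apply: le_pr => //; first exact: measurableI.
  move=> x [Ax /= hx]; split => //=; apply: (lt_le_trans hx).
  apply: (le_trans (ler_norm _)); rewrite normrM.
  by case: e1 => ->; rewrite ?normrN normr1 mul1r.
have := side 1 (or_introl erefl); have := side (-1) (or_intror erefl).
have : pr ((G `&` A) `&` [set x | k%:R * M < `|f x|]) <=
    pr (G `&` (A `&` [set x | k%:R * M < 1 * f x])) +
    pr (G `&` (A `&` [set x | k%:R * M < -1 * f x])).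
  apply: pr_le_cover; [|exact: measurableI|exact: measurableI|].
    by apply: measurableI => //; exact: measurableI.
  move=> x [[Gx Ax] /=]; case: (ger0P (f x)) => _ hx; [left|right].
  - by split=> //; split=> //=; rewrite mul1r.
  - by split=> //; split=> //=; rewrite mulN1r.
set a1 := pr _; set a2 := pr _; set a3 := pr _; set g := pr _; set E := expR _.
have -> : 4 * g * E = 2 * g * E + 2 * g * E by ring.
move: (2 * g * E) a1 a2 a3 => *; lra.
Qed.

End halfspaces.

(** If [G] is too large, [step] makes the ratio of [pr (G & A)] to the root of [pr A] arbitrarily
    large, although it is at most 1. A cut that doubles the ratio always exists: otherwise the
    coordinates have exponential tails on [G & A] at the scale of their quantiles, and integrating
    the r-th power of the norm contradicts [quantile_sum_lt]. *)
Lemma strong_tail : exists D : R, 1 <= D /\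
  forall d (T : measurableType d) (P : probability T R)
    (comb : R -> T -> T -> T) (n : nat) (f : 'I_n -> T -> R) (r p s : R),
    brunn_minkowski P comb ->
    (forall i, measurable_fun setT (f i)) -> (forall i, comb_affine comb (f i))
      ->
    1 <= r -> 1 <= p -> 0 < s ->
    (forall c : 'I_n -> R,
      (forall v : 'I_n -> R, `|\sum_i c i * v i| `^ r <= \sum_i `|v i| `^ r) ->
      (\int[P]_x (`|\sum_i c i * f i x| `^ p)%:E <= (s `^ p)%:E)%E) ->
    (\int[P]_x ((\sum_i `|f i x| `^ r) `^ r^-1)%:E <= s%:E)%E ->
    pr P [set x | (D * r * s) `^ r < \sum_i `|f i x| `^ r] <= expR (- (5 * p)).
Proof.
have [Lam [Lam2 qsum]] := @quantile_sum_lt R.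
(* This bounds the relative exponential moment on [G & A], with 4 from [no_gain_exp_tail]. As
   [1 <= c] and [1 <= r], it is at most its own r-th power and is absorbed in the threshold. *)
pose c : R := expR 1 + 4.
have c1 : 1 <= c by have := @expR_gt0 R 1; rewrite /c; lra.
exists (c * Lam); split; first by rewrite mulr_ege1//; lra.
move=> d T P comb n f r p s BM mf af r1 p1 s0 weak mean.
have r0 : 0 < r by lra.
rewrite leNgt; apply/negP => pG.
set G := [set x | _] in pG.
have mN := @measurable_power_sum R d T n f r mf.
have mG : measurable G by exact: measurable_gt.
have step (k : nat) : exists A, [/\ measurable A, comb_convex comb A, 0 < pr P
  A &
    2 ^+ k * expR (- (5 * p)) * Num.sqrt (pr P A) <= pr P (G `&` A)].
  elim: k => [|k [A [mA cA pA gA]]].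
    exists setT; split=> //; first by rewrite prT.
    by rewrite setIT prT sqrtr1 mulr1 expr0 mul1r ltW.
  apply: contrapT => nogain.
  have mGA : measurable (G `&` A) by exact: measurableI.
  have sA : 0 < Num.sqrt (pr P A) by rewrite sqrtr_gt0.
  have pGA : 0 < pr P (G `&` A).
    by apply: lt_le_trans gA; rewrite !mulr_gt0 ?expR_gt0// exprn_gt0.
  (* This bound does not depend on [k]: [G & A] lies in [A], and [2 ^+ k] is at least 1. *)
  have pA2 : expR (- (2 * (5 * p))) <= pr P A.
    have h1 : 2 ^+ k * expR (- (5 * p)) * Num.sqrt (pr P A) <=
        Num.sqrt (pr P A) * Num.sqrt (pr P A).
      rewrite -expr2 sqr_sqrtr ?pr_ge0//; apply: (le_trans gA).
      by apply: le_pr => // x [].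
    rewrite ler_pM2r// in h1.
    have h2 : expR (- (5 * p)) <= Num.sqrt (pr P A).
      by apply: le_trans h1; rewrite ler_peMl ?expR_ge0// exprn_ege1// ler1n.
    have -> : - (2 * (5 * p)) = 2%:R * (- (5 * p)) by ring.
    rewrite expRM_natl -[leRHS](sqr_sqrtr (pr_ge0 P A)).
    by rewrite lerXn2r ?nnegrE ?expR_ge0 ?sqrtr_ge0.
  have t0 : 0 < s / n.+1%:R by rewrite divr_gt0.
  have /choice[M hM] : forall i, exists Mi, [/\ s / n.+1%:R <= Mi,
      pr P (A `&` [set x | Mi < `|f i x|]) <= expR (- 9) * pr P A &
      Mi = s / n.+1%:R \/
      expR (- 9) * pr P A < pr P (A `&` [set x | Mi / 2 < `|f i x|])].
    move=> i; apply: (@exists_dyadic_quantile R d T P A (fun x =>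
      `|f i x|)) => //.
    exact: measurableT_comp.
  have Ssum := qsum d T P comb n f r p s A M BM mf af r1 p1 s0 weak mean mA cA
    pA2 hM.
  have M0 i : 0 < M i by have [h _ _] := hM i; exact: lt_le_trans h.
  have ng i (e u : R) : e = 1 \/ e = -1 ->
    pr P (G `&` (A `&` [set x | u < e * f i x])) * Num.sqrt (pr P A) <=
    2 * Num.sqrt (pr P (A `&` [set x | u < e * f i x])) * pr P (G `&` A).
    move=> e1; set A' := A `&` _.
    have mA' : measurable A'.
      by apply: measurableI => //; apply: measurable_gt; exact: measurable_funM.
    have [p0|/eqP p0] := eqVneq (pr P A') 0.
      have -> : pr P (G `&` A') = 0.
        apply: le_anti; rewrite pr_ge0 andbT -p0; apply: le_pr => //.
        exact: measurableI.
      by rewrite mul0r !mulr_ge0 ?sqrtr_ge0 ?pr_ge0.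
    have pA' : 0 < pr P A' by rewrite lt0r pr_ge0 andbT; exact/eqP.
    rewrite leNgt; apply/negP => H; apply: nogain; exists A'; split => //.
      exact: comb_convex_halfspace.
    rewrite -(ler_pM2r sA); apply: le_trans (ltW H).
    have -> : 2 ^+ k.+1 * expR (- (5 * p)) * Num.sqrt (pr P A') * Num.sqrt (pr
      P A)
      = 2 * Num.sqrt (pr P A') * (2 ^+ k * expR (- (5 * p)) * Num.sqrt (pr P
        A)).
      by rewrite exprS; ring.
    by rewrite ler_wpM2l// mulr_ge0 ?sqrtr_ge0.
  pose y i x := (M i)^-1 * `|f i x|.
  have my i : measurable_fun setT (y i).
    by apply: measurable_funM => //; exact: measurableT_comp.
  have y0 i x : 0 <= y i x by rewrite mulr_ge0// invr_ge0 ltW.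
  have expy i : (\int[P]_(x in G `&` A) (expR (1 * y i x))%:E <=
      (c * pr P (G `&` A))%:E)%E.
    have one1 : 1 <= 1 :> R by [].
    have g40 : 0 <= 4 * pr P (G `&` A) by rewrite mulr_ge0 ?pr_ge0.
    rewrite [c * _]mulrDl; apply: exponential_moment => // k' k'0.
    have -> : [set x | k'%:R < y i x] = [set x | k'%:R * M i < `|f i x|].
      by apply/seteqP; split => x /=; rewrite /y ltr_pdivlMl// mulrC.
    have [_ hMi _] := hM i.
    exact: (no_gain_exp_tail BM (mf i) (af i) mA cA mG (ltW (M0 i)) hMi (ng i)
      pA).
  have w0 i : 0 <= r `^ r * M i `^ r by rewrite mulr_ge0 ?powR_ge0.
  have mexp i : measurable_fun setT (fun x => expR (1 * y i x)).
    by apply: measurableT_comp => //; exact: measurable_funM.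
  have upper := integral_weighted_le w0 mexp (fun i x => expR_ge0 _) mGA expy.
  have lower : (((c * Lam * r * s) `^ r * pr P (G `&` A))%:E <=
      \int[P]_(x in G `&` A) (\sum_i r `^ r * M i `^ r * expR (1 * y i
        x))%:E)%E.
    rewrite EFinM -prE// -(integral_cst _ mGA); apply: ge0_le_integral => //.
    - by move=> x _; rewrite lee_fin powR_ge0.
    - apply/measurable_EFinP; apply: measurable_funTS;
      apply: measurable_sum => i.
      exact: measurable_funM.
    move=> x [/= Gx _]; rewrite lee_fin; apply: (le_trans (ltW Gx)).
    apply: ler_sum => i _.
    have -> : `|f i x| = M i * y i x by rewrite /y mulrA divff ?gt_eqF// mul1r.
    rewrite powRM ?(ltW (M0 i))// mulrAC mulrC ler_wpM2r ?powR_ge0// mul1r.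
    exact: powR_le_expR.
  have := le_trans lower upper; rewrite lee_fin mulrA ler_pM2r// -mulr_sumr.
  apply/negP; rewrite -ltNge.
  have -> : c * Lam * r * s = c * (r * (Lam * s)) by ring.
  have Ls0 : 0 < Lam * s by rewrite mulr_gt0// (lt_le_trans _ Lam2).
  have c0 : 0 < c by apply: lt_le_trans c1.
  rewrite powRM ?(ltW c0)//; last by rewrite mulr_ge0 ?ltW.
  rewrite powRM ?(ltW r0) ?(ltW Ls0)//.
  apply: (@lt_le_trans _ _ (c * (r `^ r * (Lam * s) `^ r))).
    by rewrite mulrC ltr_pM2l// ltr_pM2l ?powR_gt0.
  by rewrite ler_wpM2r ?mulr_ge0 ?powR_ge0// le1r_powR.
have two1 : 1 < 2 :> R by lra.
have [k] := exists_expn_ge (expR (5 * p) + 1) two1; rewrite leNgt => /negP;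
  apply.
have [A [mA _ pA gA]] := step k.
have sA : 0 < Num.sqrt (pr P A) by rewrite sqrtr_gt0.
have : 2 ^+ k * expR (- (5 * p)) * Num.sqrt (pr P A) <= 1 * Num.sqrt (pr P A).
  apply: (le_trans gA); apply: (@le_trans _ _ (pr P A)).
    by apply: le_pr => //; exact: measurableI.
  rewrite -{1}(sqr_sqrtr (pr_ge0 P A)) expr2 ler_wpM2r ?sqrtr_ge0//.
  by rewrite -[leRHS]sqrtr1 ler_wsqrtr// pr_le1.
rewrite ler_pM2r// expRN ler_pdivrMr ?expR_gt0// mul1r => H.
by rewrite ltr_pwDr.
Qed.

(** Borell's lemma with [b = 4 * p] turns the tail at [u] into an exponential moment of order [p] of
    [h / u], which dominates the p-th power. The rate 5 rather than 4 provides a factor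
    [expR (- p)], at most 1/2, for the [1 - e] in Borell's lemma. *)
Lemma moment_of_tail d (T : measurableType d) (P : probability T R)
    (comb : R -> T -> T -> T) (h : T -> R) (p u : R) :
  brunn_minkowski P comb -> measurable_fun setT h -> (forall x, 0 <= h x) ->
  comb_reverse_triangle comb h -> 1 <= p -> 0 < u ->
  pr P [set x | u < h x] <= expR (- (5 * p)) ->
  (\int[P]_x (h x `^ p)%:E <= ((expR 2 * u) `^ p)%:E)%E.
Proof.
move=> BM mh h0 rh p1 u0 tail.
have p0 : 0 < p by lra.
have cT : comb_convex comb setT by [].
have b0 : 0 <= 4 * p by lra.
have eb : expR (- (5 * p)) <= expR (- (4 * p)) * (1 - expR (- (5 * p))).
  have h1 : expR (- 1) <= 2^-1 :> R.
    by rewrite expRN lef_pV2 ?posrE ?expR_gt0// expR1_ge2.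
  have h2 : expR (- p) <= expR (- 1) by rewrite ler_expR; lra.
  have h3 : expR (- (5 * p)) <= expR (- p) by rewrite ler_expR; lra.
  have {1}-> : - (5 * p) = - (4 * p) + - p by ring.
  by rewrite expRD ler_wpM2l ?expR_ge0//; lra.
have tail1 : pr P (setT `&` [set x | u < h x]) <= expR (- (5 * p)) * pr P setT.
  by rewrite setTI prT mulr1.
have bt := borell BM measurableT cT mh rh (ltW u0) b0 (expR_ge0 _) eb tail1.
pose y x := u^-1 * h x.
have my : measurable_fun setT y by exact: measurable_funM.
have y0 x : 0 <= y x by rewrite mulr_ge0// invr_ge0 ltW.
have my' : measurable_fun setT (fun x => expR (p * y x)).
  by apply: measurableT_comp => //; exact: measurable_funM.
have expm : (\int[P]_x (expR (p * y x))%:E <= (expR p * pr P setT + 1)%:E)%E.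
  apply: exponential_moment => // k k0.
  have -> : [set x | k%:R < y x] = [set x | k%:R * u < h x].
    by apply/seteqP; split => x /=; rewrite /y ltr_pdivlMl// mulrC.
  apply: le_trans (bt _ k0) _; rewrite prT mulr1 mul1r ler_expR.
  by have -> : 4 * p * k.+1%:R / 2 = 2 * p * k.+1%:R by field.
apply: (@le_trans _ _ (\int[P]_x (u `^ p * expR (p * y x))%:E)%E).
  apply: ge0_le_integral => //.
  - by move=> x _; rewrite lee_fin powR_ge0.
  - by apply/measurable_EFinP; exact: measurable_fun_powR.
  - by apply/measurable_EFinP; exact: measurable_funM.
  move=> x _; rewrite lee_fin.
  have -> : h x = u * y x by rewrite /y mulrA divff ?gt_eqF// mul1r.
  rewrite powRM ?(ltW u0)// ler_wpM2l ?powR_ge0// mulrC expRM.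
  apply: ge0_ler_powR; rewrite ?nnegrE ?expR_ge0 ?(ltW p0)//.
  by apply: le_trans (expR_ge1Dx _); lra.
rewrite ge0_integral_scale ?powR_ge0//.
apply: (@le_trans _ _ ((u `^ p)%:E * (expR p * pr P setT + 1)%:E)%E).
  by rewrite lee_wpmul2l// lee_fin powR_ge0.
rewrite -EFinM lee_fin prT mulr1 [expR 2 * u]mulrC powRM ?(ltW u0) ?expR_ge0//.
rewrite ler_wpM2l ?powR_ge0// -expRM.
have -> : 2 * p = p + p by ring.
rewrite expRD.
have : 2 <= expR p by apply: (le_trans (expR1_ge2 R)); rewrite ler_expR.
by move: (expR p) => E E2; nra.
Qed.

End strong_tail.

(** * Radon measures on a normed space embedded in l_r *)

Section normed_space.
Context (R : realType) (F : normedModType R).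

Definition mix (l : R) (x y : borel F) : borel F :=
  (l *: (x : F) + (1 - l) *: (y : F) : F).

Lemma borel_open (A : set F) : open A -> measurable (A : set (borel F)).
Proof. exact: sub_gen_smallest. Qed.

Lemma borel_closed (A : set F) : closed A -> measurable (A : set (borel F)).
Proof.
by move=> cA; rewrite -[A]setCK; apply: measurableC; apply: borel_open;
  exact: closed_openC.
Qed.

Lemma borel_compact (A : set F) : compact A -> measurable (A : set (borel F)).
Proof. by move=> /(compact_closed (@norm_hausdorff _ F));
  exact: borel_closed. Qed.

Lemma continuous_borel (f : F -> R) : continuous f ->
  measurable_fun setT (f : borel F -> R).
Proof.
move=> cf; apply: (measurability _ (RGenOInfty.measurableE R)).
move=> _ [_ [a ->] <-]; rewrite setTI; apply: borel_open.
by move/continuousP : cf; apply; exact: interval_open.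
Qed.

Lemma compact_mix (l : R) (K L : set F) : compact K -> compact L ->
  compact ([set l *: x + (1 - l) *: y | x in K & y in L] : set F).
Proof.
move=> cK cL.
have -> : [set l *: x + (1 - l) *: y | x in K & y in L] =
    [set (fun z : F * F => l *: z.1 + (1 - l) *: z.2) z | z in K `*` L].
  apply/seteqP; split => [_ [x Kx [y Ly <-]]|_ [[x y] [/= Kx Ly] <-]].
    by exists (x, y).
  by exists x => //; exists y.
apply: continuous_compact; last exact: compact_setX.
apply: continuous_subspaceT => z.
apply: cvgD; apply: cvgZr; [exact: cvg_fst|exact: cvg_snd].
Qed.

(** Approximate [B] and [K] from inside by compact sets carrying a proportion [t < 1] of their
    masses. The combination of two compact sets is compact, hence Borel, and the exponents [l] and
    [1 - l] add up to 1, so only the factor [t] is lost. *)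
Lemma radon_brunn_minkowski (mu : probability (borel F) R) :
  radon mu -> log_concave mu -> brunn_minkowski mu mix.
Proof.
move=> rad lc l B K Z l01 mB mK mZ BKZ.
have [l0 l1] : 0 < l /\ 0 < 1 - l by lra.
have inner (A : set (borel F)) (t : R) : measurable A -> 0 < pr mu A ->
    0 < t < 1 -> exists C : set F, [/\ compact C, C !=set0, C `<=` A &
      t * pr mu A <= pr mu C].
  move=> mA pA t01; have := rad A mA => muA.
  have : ((t * pr mu A)%:E < ereal_sup [set (mu : {measure set (borel F) ->
    \bar R}) C |
      C in [set C : set F | compact C /\ C `<=` A]])%E.
    rewrite -muA prE// lte_fin gtr_pMl//; lra.
  move=> /ereal_sup_gt[_ [C [cC CA] <-]].
  have mC := borel_compact cC; rewrite (prE mu mC) lte_fin => tC.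
  exists C; split => //; last exact: ltW.
  apply/set0P/negP => /eqP C0; move: tC; rewrite C0 /pr measure0/=.
  by apply/negP; rewrite -leNgt mulr_ge0// ltW//; case/andP: t01.
have Z0 := pr_ge0 mu Z.
(* Null sets have no compact subset of positive mass; here the left side is 0 since both exponents
   are positive. *)
have [B0|/eqP B0] := eqVneq (pr mu B) 0.
  by rewrite B0 powR0 ?mul0r// gt_eqF.
have [K0|/eqP K0] := eqVneq (pr mu K) 0.
  by rewrite K0 [X in _ * X]powR0 ?mulr0// gt_eqF.
have pB : 0 < pr mu B by rewrite lt0r pr_ge0 andbT; exact/eqP.
have pK : 0 < pr mu K by rewrite lt0r pr_ge0 andbT; exact/eqP.
set Q := _ * _; have Q0 : 0 < Q by rewrite mulr_gt0// powR_gt0.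
suff tQ t : 0 < t < 1 -> t * Q <= pr mu Z.
  rewrite leNgt; apply/negP => ZQ.
  have /tQ : 0 < (pr mu Z / Q + 1) / 2 < 1.
    have : 0 <= pr mu Z / Q by rewrite divr_ge0// ltW.
    have : pr mu Z / Q < 1 by rewrite ltr_pdivrMr// mul1r.
    by move: (pr mu Z / Q) => v; lra.
  have -> : (pr mu Z / Q + 1) / 2 * Q = (pr mu Z + Q) / 2.
    by field; rewrite gt_eqF.
  lra.
move=> t01.
have [C [cC C0 CB pC]] := inner B t mB pB t01.
have [D [cD D0 DK pD]] := inner K t mK pK t01.
have l01' : (0 <= l <= 1)%R by lra.
have := lc C D l cC C0 cD D0 l01'.
set S := [set _ | _ in _ & _ in _] => lcS.
have mS : measurable (S : set (borel F)) by apply: borel_compact;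
  exact: compact_mix.
have SZ : S `<=` Z by move=> _ [x Cx [y Dy <-]]; apply: BKZ;
  [exact: CB|exact: DK].
have pSZ := le_pr mu mS mZ SZ.
have pCD : pr mu C `^ l * pr mu D `^ (1 - l) <= pr mu S.
  rewrite -lee_fin EFinM -!poweR_EFin.
  rewrite -(prE mu (borel_compact cC)) -(prE mu (borel_compact cD)) -(prE mu
    mS).
  exact: lcS.
apply: le_trans (le_trans pCD pSZ).
have -> : t * Q = (t * pr mu B) `^ l * (t * pr mu K) `^ (1 - l).
  have t0 : 0 <= t by lra.
  rewrite !powRM ?pr_ge0// mulrACA -powRD; last first.
    by apply/implyP => _; rewrite gt_eqF//; lra.
  by have -> : l + (1 - l) = 1 by [ring]; rewrite powRr1.
have tp A : 0 <= t * pr mu A by rewrite mulr_ge0 ?pr_ge0//; lra.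
apply: ler_pM; rewrite ?powR_ge0//.
- by apply: ge0_ler_powR; rewrite ?nnegrE ?pr_ge0 ?(ltW l0).
- by apply: ge0_ler_powR; rewrite ?nnegrE ?pr_ge0 ?(ltW l1).
Qed.

Lemma continuous_norm_bounded (phi : {linear F -> R}) :
  (forall x, `|phi x| <= `|x|) -> continuous (phi : F -> R).
Proof.
move=> phib x; apply/cvgrPdist_lt => e e0; near=> z.
rewrite -linearB; apply: le_lt_trans (phib _) _.
by near: z; apply: cvgr_dist_lt => //; exact: cvg_id.
Unshelve. all: by end_near. Qed.

End normed_space.

(** * Coordinates of the embedding into l_r *)

Section ell_embedding.
Context (R : realType) (F : normedModType R) (r : R).
Context (f : {linear F -> (nat -> R)}).

Lemma embedding_series : 1 <= r ->
  (forall x : F, 'N[counting]_r%:E [EFin \o f x] = (`|x|%R)%:E)%E ->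
  forall x : F, (\sum_(k <oo) (`|f x k| `^ r)%:E = (`|x| `^ r)%:E)%E.
Proof.
move=> r1 fN x; have r0 : 0 < r by lra.
rewrite -poweR_EFin -fN Lnorm_counting// -poweRrM mulVf ?gt_eqF// poweRe1//.
by apply: nneseries_ge0 => k _ _; exact: poweR_ge0.
Qed.

Lemma embedding_partial_sum :
  (forall x : F, (\sum_(k <oo) (`|f x k| `^ r)%:E = (`|x| `^ r)%:E)%E) ->
  forall (x : F) (n : nat), \sum_(i < n) `|f x i| `^ r <= `|x| `^ r.
Proof.
move=> fS x n; rewrite -lee_fin -fS -sumEFin -(big_mkord xpredT (fun i =>
  (`|f x i| `^ r)%:E)).
by apply: nneseries_lim_ge => k _ _; rewrite lee_fin powR_ge0.
Qed.

Lemma embedding_exceeds :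
  (forall x : F, (\sum_(k <oo) (`|f x k| `^ r)%:E = (`|x| `^ r)%:E)%E) ->
  forall (x : F) (u : R), u < `|x| `^ r ->
  exists n, u < \sum_(i < n) `|f x i| `^ r.
Proof.
move=> fS x u ux; apply: contrapT => /forallNP le_u.
suff : ((`|x| `^ r)%:E <= u%:E)%E by rewrite lee_fin leNgt ux.
rewrite -fS; apply: lime_le.
  by apply: is_cvg_nneseries => k _ _; rewrite lee_fin powR_ge0.
apply: nearW => n; rewrite big_mkord sumEFin lee_fin leNgt.
by apply/negP; exact: le_u.
Qed.

(** This lets the weak moment over the dual ball of [F] control combinations of finitely many
    coordinates: keeping only the first [n] does not increase the norm. *)
Lemma embedding_functional (n : nat) (c : 'I_n -> R) : 0 < r ->
  (forall x : F, (\sum_(k <oo) (`|f x k| `^ r)%:E = (`|x| `^ r)%:E)%E) ->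
  (forall v : 'I_n -> R, `|\sum_i c i * v i| `^ r <= \sum_i `|v i| `^ r) ->
  exists2 phi : {linear F -> R}, dual_ball F phi &
    forall x, phi x = \sum_i c i * f x i.
Proof.
move=> r0 fS dualc; pose g (x : F) : R := \sum_i c i * f x i.
have glin : linear g.
  move=> a x y; rewrite /g scaler_sumr -big_split; apply: eq_bigr => i _ /=.
  have -> : f (a *: x + y) i = a * f x i + f y i by rewrite linearP.
  by rewrite mulrDr mulrCA.
pose phi : {linear F -> R} := HB.pack g (GRing.isLinear.Build R F R *:%R g
  glin).
have phiN x : `|phi x| <= `|x|.
  rewrite leNgt; apply/negP => lt_x.
  have := le_trans (dualc (fun i => f x i)) (embedding_partial_sum fS x n).
  apply/negP; rewrite -ltNge.
  by apply: gt0_ltr_powR; rewrite ?nnegrE.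
exists phi => //; split; first exact: continuous_norm_bounded.
by apply: ge_ereal_sup => _ [x x1 <-]; rewrite lee_fin (le_trans (phiN x)).
Qed.

End ell_embedding.

Section embedded_moments.
Context (R : realType).

Lemma pr_bigcup_le d (T : measurableType d) (P : probability T R)
    (E : nat -> set T) (u : R) :
  (forall n, measurable (E n)) -> nondecreasing_seq E ->
  (forall n, pr P (E n) <= u) -> pr P (\bigcup_n E n) <= u.
Proof.
move=> mE ndE Eu; have mU : measurable (\bigcup_n E n) by exact:
  bigcup_measurable.
rewrite -lee_fin -prE//.
have cvgE := nondecreasing_cvg_mu (mu := P) mE mU ndE.
rewrite -(cvg_lim _ cvgE)//; apply: lime_le; first by apply/cvg_ex; eexists;
  exact: cvgE.
by apply: nearW => n /=; rewrite prE// lee_fin.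
Qed.

(** The bound of [strong_tail] for the first [n] coordinates is the same for all [n], and the events
    increase with [n] to cover the tail event of the norm. Continuity from below and
    [moment_of_tail] conclude. *)
Lemma embedded_moment_bound : exists2 D : R, 1 <= D &
  forall (F : normedModType R) (mu : probability (borel F) R) (r p s : R),
    isometrically_embeds_in_ell r F -> radon mu -> log_concave mu ->
    1 <= r -> 1 <= p -> 0 < s ->
    (\int[mu]_x (`|(x : F)|)%:E <= s%:E)%E ->
    (forall phi : {linear F -> R}, dual_ball F phi ->
      (\int[mu]_x (`|phi (x : F)| `^ p)%:E <= (s `^ p)%:E)%E) ->
    (\int[mu]_x (`|(x : F)| `^ p)%:E <= ((D * r * s) `^ p)%:E)%E.
Proof.
have [D [D1 tail]] := strong_tail R.
exists (expR 2 * D).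
  have e2 : 1 <= expR 2 :> R by rewrite -[leLHS]expR0 ler_expR.
  exact: mulr_ege1.
move=> F mu r p s [f fN] rad lc r1 p1 s0 mean weak.
have r0 : 0 < r by lra.
have BM := radon_brunn_minkowski rad lc.
have fS := embedding_series r1 fN.
pose g n (i : 'I_n) (x : borel F) : R := f (x : F) i.
have glin i (l : R) (x v : F) :
    f (l *: x + (1 - l) *: v) i = l * f x i + (1 - l) * f v i.
  by rewrite linearD !linearZ.
have ag n (i : 'I_n) : comb_affine (@mix R F) (g n i).
  by move=> l x v _; exact: glin.
have f_le i (x : F) : `|f x i| <= `|x|.
  rewrite leNgt; apply/negP => lt_x.
  have := embedding_partial_sum fS x i.+1.
  apply/negP; rewrite -ltNge big_ord_recr/=.
  apply: (@lt_le_trans _ _ (`|f x i| `^ r)).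
    by apply: gt0_ltr_powR; rewrite ?nnegrE.
  by rewrite lerDr sumr_ge0// => j _; exact: powR_ge0.
have mg n (i : 'I_n) : measurable_fun setT (g n i).
  apply: continuous_borel => x; apply/cvgrPdist_lt => e e0; near=> z.
  have -> : f x i - f z i = f (x - z) i by rewrite linearB.
  apply: le_lt_trans (f_le _ _) _.
  by near: z; apply: cvgr_dist_lt => //; exact: cvg_id.
have mnorm : measurable_fun setT (fun x : borel F => `|(x : F)|).
  by apply: continuous_borel => x; exact: norm_continuous.
have norm_sum n (x : borel F) :
    (\sum_i `|g n i x| `^ r) `^ r^-1 <= `|(x : F)|.
  have -> : `|(x : F)| = (`|(x : F)| `^ r) `^ r^-1.
    by rewrite -powRrM mulfV ?gt_eqF// powRr1.
  apply: ge0_ler_powR; rewrite ?nnegrE ?powR_ge0 ?invr_ge0 ?(ltW r0)//.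
    by apply: sumr_ge0 => i _; exact: powR_ge0.
  exact: embedding_partial_sum.
have tailn n := tail _ _ mu _ n (g n) r p s BM (mg n) (ag n) r1 p1 s0.
pose E n := [set x : borel F | (D * r * s) `^ r < \sum_i `|g n i x| `^ r].
have mE n : measurable (E n).
  by apply: measurable_gt; exact: measurable_power_sum.
have pE n : pr mu (E n) <= expR (- (5 * p)).
  apply: tailn => [c dualc|].
    have [phi phiball phiE] := embedding_functional r0 fS dualc.
    have := weak _ phiball.
    by under eq_integral do rewrite phiE.
  apply: le_trans mean; apply: ge0_le_integral => //.
  - by move=> x _; rewrite lee_fin powR_ge0.
  - apply/measurable_EFinP; apply: measurable_fun_powR.
    exact: measurable_power_sum.
  - exact/measurable_EFinP.
  - by move=> x _; rewrite lee_fin norm_sum.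
have ndE : nondecreasing_seq E.
  apply/nondecreasing_seqP => n; apply/subsetPset => x /= /lt_le_trans; apply.
  by rewrite [leRHS]big_ord_recr/= lerDl powR_ge0.
have u0 : 0 < D * r * s by rewrite !mulr_gt0//; lra.
have pnorm : pr mu [set x : borel F | D * r * s < `|(x : F)|] <= expR (- (5 *
  p)).
  apply: le_trans (pr_bigcup_le mE ndE pE); apply: le_pr.
  - exact: measurable_gt.
  - exact: bigcup_measurable.
  move=> x /= ux; have [|n En] := embedding_exceeds fS (x := x) (u := (D * r *
    s) `^ r).
    by apply: gt0_ltr_powR; rewrite ?nnegrE ?(ltW u0).
  by exists n.
have rtri : comb_reverse_triangle (@mix R F) (fun x : borel F => `|(x : F)|).
  move=> l x v l01; rewrite /mix.
  have -> : l *: (x : F) + (1 - l) *: (v : F) =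
    l *: (x : F) - (- ((1 - l) *: (v : F))) by rewrite opprK.
  apply: le_trans (lerB_dist _ _); rewrite normrN !normrZ.
  by rewrite !ger0_norm//; clear -l01; lra.
have := moment_of_tail BM mnorm (fun x => normr_ge0 _) rtri p1 u0 pnorm.
by rewrite !mulrA.
Unshelve. all: by end_near. Qed.

End embedded_moments.

(** * From the law of [X] to expectations *)

Local Open Scope ereal_scope.

Theorem theorem2 (R : realType) :
  exists C2 : R, (1 <= C2)%R /\
  forall (r : R) (F : normedModType R)
    (d : measure_display) (Omega : measurableType d) (P : probability Omega R)
    (X : {RV P >-> borel F}),
    (1 <= r)%R ->
    isometrically_embeds_in_ell r F ->
    radon (distribution P X) ->
    log_concave (distribution P X) ->
    forall p : R, (1 <= p)%R ->
      'E_P[fun w => (`|(X w : F)| `^ p)%R] `^ p^-1 <=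
      (C2 * r)%:E *
      ('E_P[fun w => `|(X w : F)|%R] +
       ereal_sup [set 'E_P[fun w => (`|phi (X w : F)| `^ p)%R] `^ p^-1
                 | phi in dual_ball F]).
Proof.
have [D D1 moment] := embedded_moment_bound R.
exists D; split=> // r F d Omega P X r1 emb rad lc p p1.
have p0 : (0 < p)%R by lra.
have Dr0 : (0 < D * r)%R by rewrite mulr_gt0//; lra.
have EX (h : F -> R) : continuous h -> (forall x, 0 <= h x)%R ->
    'E_P[fun w => h (X w : F)] = \int[distribution P X]_x (h (x : F))%:E.
  move=> ch h0; rewrite unlock ge0_integral_distribution//.
  by apply/measurable_EFinP; exact: continuous_borel.
have EXp (h : F -> R) : continuous h -> (forall x, 0 <= h x)%R ->
    'E_P[fun w => (h (X w : F) `^ p)%R] =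
    \int[distribution P X]_x (h (x : F) `^ p)%:E.
  move=> ch h0; rewrite unlock (ge0_integral_distribution X
    (f := fun x : borel F => (h (x : F) `^ p)%:E))//.
  - by apply/measurable_EFinP; apply: measurable_fun_powR;
    exact: continuous_borel.
  - by move=> x; rewrite lee_fin powR_ge0.
set m := 'E_P[fun w => `|(X w : F)|%R]; set S := ereal_sup _.
have m0 : 0 <= m by exact: expectation_ge0.
(* The supremum runs over a nonempty set: the empty combination of coordinates is the zero
   functional. *)
have S0 : 0 <= S.
  have dual0 (v : 'I_0 -> R) :
      (`|\sum_i (fun=> 0) i * v i| `^ r <= \sum_i `|v i| `^ r)%R.
    by rewrite !big_ord0 normr0 powR0// gt_eqF//; lra.
  have [f fN] := emb; have r0 : (0 < r)%R by lra.
  have [phi phib _] := embedding_functional r0 (embedding_series r1 fN) dual0.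
  apply: le_trans (poweR_ge0 _ _) (ereal_sup_ubound _).
  by exists phi.
have pinf x : 0 <= x -> (D * r)%:E * (x + +oo) = +oo.
  by move=> x0; rewrite addey ?gt0_muley ?lte_fin// gt_eqF// (lt_le_trans _
    x0)// ltNyr.
have [->|mfin] := eqVneq m +oo; first by rewrite addeC pinf// leey.
have [->|Sfin] := eqVneq S +oo; first by rewrite pinf// leey.
have mE : m = (fine m)%:E by rewrite fineK// ge0_fin_numE// lt_neqAle mfin leey.
have SE : S = (fine S)%:E by rewrite fineK// ge0_fin_numE// lt_neqAle Sfin leey.
have [fm0 fS0] : (0 <= fine m)%R /\ (0 <= fine S)%R by rewrite !fine_ge0.
rewrite mE SE -EFinD -EFinM; apply/lee_addgt0Pr => e e0.
(* [moment] requires a positive [s], while [m] and [S] may both vanish; the added term becomes [e]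
   after multiplication by [D * r]. *)
pose s : R := (fine m + fine S + e / (D * r))%R.
have er0 : (0 < e / (D * r))%R by rewrite divr_gt0.
have s0 : (0 < s)%R by rewrite /s; lra.
have normc : continuous (fun x : F => `|x|%R) by move=> x;
  exact: norm_continuous.
have mean : \int[distribution P X]_x (`|(x : F)|%R)%:E <= s%:E.
  by rewrite -(EX _ normc)// -/m mE lee_fin /s; lra.
have weak (phi : {linear F -> R}) : dual_ball F phi ->
    \int[distribution P X]_x (`|phi (x : F)| `^ p)%:E <= (s `^ p)%:E.
  move=> phib; have [phic _] := phib.
  rewrite -(EXp (fun x => `|phi x|%R))//; last first.
    by move=> x; apply: continuous_comp; [exact: phic|exact: norm_continuous].
  set I := 'E_P[_].
  have I0 : 0 <= I by apply: expectation_ge0 => w; exact: powR_ge0.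
  have IS : I `^ p^-1 <= (fine S)%:E.
    by rewrite -SE; apply: ereal_sup_ubound; exists phi.
  have -> : I = (I `^ p^-1) `^ p by rewrite -poweRrM mulVf ?gt_eqF// poweRe1.
  rewrite -poweR_EFin; apply: gt0_ler_poweR.
  - exact: ltW.
  - by rewrite in_itv/= poweR_ge0 leey.
  - by rewrite in_itv/= lee_fin (ltW s0) leey.
  - by apply: (le_trans IS); rewrite lee_fin /s; lra.
have := moment F (distribution P X) r p s emb rad lc r1 p1 s0 mean weak.
rewrite -(EXp (fun x => `|x|%R))// => bound.
apply: (@le_trans _ _ (((D * r * s) `^ p)%:E `^ p^-1)).
  apply: gt0_ler_poweR => //.
  - by rewrite invr_ge0 ltW.
  - rewrite in_itv/= leey andbT; apply: expectation_ge0 => w; exact: powR_ge0.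
  - by rewrite in_itv/= lee_fin powR_ge0 leey.
rewrite poweR_EFin -powRrM mulfV ?gt_eqF// powRr1; last first.
  by rewrite mulr_ge0 ?ltW.
by rewrite -EFinD lee_fin /s mulrDr (mulrC _ (e / _)%R) divfK ?gt_eqF.
Qed.
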